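(* Let $d\ge2$ and $n\geq 3$ be integers and let $U\in \mathrm{U}(\mathcal{H}_{d})$. Then the $(n-1)$-controlled gate $\mathrm{C}^{n}_{(1,\dots,n-1),n}(U)$ can be synthesized using at most $$N_{\mathrm{U}}(d,n)=2+\sum^{n}_{m=3}\min\{N_{\mathrm{SU}}^{\mathrm{rec}}(m),N_{\mathrm{SU}}(d,m)\}$$ CINC gates, where for $3\le m\le 6$ the minimum is taken to be $N_{\mathrm{SU}}^{\mathrm{rec}}(m)$ (because $N_{\mathrm{SU}}(d,m)$ is undefined for such $m$). Moreover, when $n\geq 7$, $$N_{\mathrm{U}}(d,n)\leq\begin{cases}8n^2-40n+12, & \text{if } d=2,\\ 16n^2-144n+348, & \text{if } d=3,\\ (16d-20)n^2-(176d-252)n+(490d-732), & \text{if } d\geq4.\end{cases}$$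
   Context: For $m\ge3$, $N^{\mathrm{rec}}_{\mathrm{SU}}(m)=2^{2k}+3\cdot 2^{k}(m-2^{k}-1)$ with $k=\lfloor\log_2(m-1)\rfloor$. For $m\ge 7$, $N_{\mathrm{SU}}(d,m)$ equals $16m-48$ if $d=2$, $32m-160$ if $d=3$, and $(32d-40)m-192d+272$ if $d\ge4$. $\mathcal{H}_{d}$ is a $d$-dimensional complex Hilbert space with orthonormal (computational) basis $|0\rangle,\dots,|d-1\rangle$ (a qudit); $\mathrm{U}(\mathcal{H})$ is the group of unitary operators on $\mathcal{H}$. $X_d=|0\rangle\langle d-1|+\sum_{a=0}^{d-2}|a+1\rangle\langle a|$. For distinct indices $i_1,\dots,i_r,j\in\{1,\dots,n\}$ and $U\in\mathrm{U}(\mathcal{H}_d)$, the gate $\mathrm{C}^{n}_{(i_1,\dots,i_r),j}(U)\in\mathrm{U}(\mathcal{H}_d^{\otimes n})$ acts on a computational basis vector $|x_1\dots x_n\rangle$ by applying $U$ to the $j$-th tensor factor if $x_{i_1}=\dots=x_{i_r}=d-1$, and as the identity otherwise. A CINC gate is any $\mathrm{C}^{n}_{i,j}(X_d)$ with $i\neq j$. A single-qudit gate is an arbitrary unitary acting nontrivially on one tensor factor only. ''Synthesized using at most $N$ CINC gates'' means: equal, as an operator on the given $n$ qudits (no ancilla), to a finite product of CINC gates and single-qudit gates in which at most $N$ factors are CINC gates (the number of single-qudit gates is not restricted). *)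

(* Defs.v *)
From HB Require Import structures.
From mathcomp Require Import all_boot all_order all_algebra.
From mathcomp Require Import complex reals.

Set Implicit Arguments.
Unset Strict Implicit.
Unset Printing Implicit Defensive.

Import Order.TTheory GRing.Theory Num.Theory.

Local Open Scope ring_scope.

(* The basis vector |x_1 ... x_n> is the function x; tensor factor
   number k is the index k - 1 of 'I_n. *)
Definition basis (n d : nat) : finType := {ffun 'I_n -> 'I_d}.

Section Gates.
Variables (R : realType) (n d : nat).

(* Operators on the n-fold tensor power of C^d, as matrices acting on column
   vectors in the computational basis. *)
Definition qop := 'M[R[i]]_#|basis n d|.

(* The operator with matrix coefficients <x| A |y> = K x y. *)
Definition qop_of (K : basis n d -> basis n d -> R[i]) : qop :=
  \matrix_(a, b) K (enum_val a) (enum_val b).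

(* <x| (1 (x) ... (x) V (x) ... (x) 1) |y>, with V on the j-th factor. *)
Definition local_coef (j : 'I_n) (V : 'M[R[i]]_d) (x y : basis n d) : R[i] :=
  if [forall k, (k != j) ==> (x k == y k)] then V (x j) (y j) else 0.

Definition local_gate (j : 'I_n) (V : 'M[R[i]]_d) : qop :=
  qop_of (local_coef j V).

(* C_{S,j}(V): the column of |y> is that of V on the j-th factor when all
   y_i with i in S are the last level d - 1, and |y> otherwise. It is the gate
   intended only for j \notin S. *)
Definition ctrl_gate (S : {set 'I_n}) (j : 'I_n) (V : 'M[R[i]]_d) : qop :=
  qop_of (fun x y =>
    if [forall i in S, (y i).+1 == d :> nat] then local_coef j V x y
    else (x == y)%:R).

Definition shift_mx : 'M[R[i]]_d :=
  \matrix_(b < d, a < d) (b == a.+1 %% d :> nat)%N%:R.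

Inductive gate :=
| Single of 'I_n & 'M[R[i]]_d
| CINC of 'I_n & 'I_n.

Definition gate_op (g : gate) : qop :=
  match g with
  | Single j V => local_gate j V
  | CINC i j => ctrl_gate [set i] j shift_mx
  end.

Definition wf_gate (g : gate) : bool :=
  match g with
  | Single _ V => V \is unitarymx
  | CINC i j => i != j
  end.

Definition is_CINC (g : gate) : bool :=
  if g is CINC _ _ then true else false.

Definition synthesizable (A : qop) (N : int) : Prop :=
  exists c : seq gate,
    [/\ all wf_gate c,
        A = \big[mulmx/1%:M]_(g <- c) gate_op g
      & (count is_CINC c)%:Z <= N].

End Gates.

(* The counts are integers, so that no subtraction is truncated. *)

Definition N_SU_rec (m : nat) : int :=
  let k := trunc_log 2 m.-1 in
  2 ^+ (2 * k) + 3 * 2 ^+ k * (m%:Z - 2 ^+ k - 1).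

(* Meaningful only for m >= 7. *)
Definition N_SU (d m : nat) : int :=
  if d == 2%N then 16 * m%:Z - 48
  else if d == 3%N then 32 * m%:Z - 160
  else (32 * d%:Z - 40) * m%:Z - 192 * d%:Z + 272.

Definition N_U (d n : nat) : int :=
  2 + \sum_(3 <= m < n.+1)
        (if (m <= 6)%N then N_SU_rec m
         else Num.min (N_SU_rec m) (N_SU d m)).

(* Main.v *)
Require Import Defs.
From HB Require Import structures.
From mathcomp Require Import all_boot all_order all_algebra.
From mathcomp Require Import complex reals.
From mathcomp Require Import fingroup perm zify ring.

Set Implicit Arguments.
Unset Strict Implicit.
Unset Printing Implicit Defensive.

Import Order.TTheory GRing.Theory Num.Theory.

Local Open Scope ring_scope.

(** For a projection p and an operator a commuting with it, ctl p a acts as a on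
    the range of p and trivially elsewhere; controlling on S u T is nested
    control, and the commutator of ctl p a and ctl q b is ctl (p q) of the
    commutator of a and b.

    Every U in SU(d) is a commutator [P, Q] with P and Q of the form s A X A^-1
    (diagonalise U and solve U = X D X^-1 D^-1 = [X, DX] for a diagonal D).  A
    phase s only costs a single-qudit phase gate on a control, so such a gate
    with one control takes one CINC; splitting the controls in two halves and
    recursing gives N_SU_rec.

    For the linear count the controls of U = [P, Q] are again split in two
    halves, each half serving as borrowed qudits for the other.  Write X = Y Z Y^-1
    with Z diagonal, V = s Z in SU(d), and let H_ab = sum_i |i><i|_a Z^i_b.  Then
    G = H_ab C_x(Y_a) conjugates V_a into C_x(V_b) C_x((X V^-1)_a) V_a: up to
    operators that do not involve b, the control x has been added and the target
    moved from a to b.  Iterating builds a staircase N = C_S(V_b) K with K away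
    from b, and one more step G N G^-1 N^-1 cancels K.  The residual factor
    C_S((X V^-1)_a) is made diagonal by a change of basis on a; it then commutes
    with the gate of the other half and drops out of the commutator.

    Finally a gate in U(d) differs from one in SU(d) by a phase, which is a
    controlled phase gate with one control less. *)

(** * Controlled elements of a ring *)

Section Controlled.
Variable A : pzRingType.
Implicit Types p q a b u v : A.

Definition ctl p a := 1 + p * (a - 1).

Lemma ctl1 p : ctl p 1 = 1.
Proof. by rewrite /ctl subrr mulr0 addr0. Qed.

Lemma ctlM p a b : p * p = p -> GRing.comm p a ->
  ctl p (a * b) = ctl p a * ctl p b.
Proof.
move=> pp pa.
have E : p * (a - 1) * (p * (b - 1)) = p * ((a - 1) * (b - 1)).
  have pa1 : GRing.comm p (a - 1) by apply: commrB => //; apply: commr1.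
  by rewrite mulrA -[p * _ * p]mulrA -pa1 mulrA pp -mulrA.
rewrite /ctl mulrDl mul1r -addrA [(p * _) * (1 + _)]mulrDr mulr1 E -!mulrDr.
congr (1 + p * _).
rewrite -{1}[a - 1]mulr1 -mulrDr [1 + _]addrC subrK mulrBl mul1r.
by rewrite [RHS]addrC addrA subrK.
Qed.

Lemma ctl_ctl p q a : ctl p (ctl q a) = ctl (p * q) a.
Proof. by rewrite /ctl [1 + q * _]addrC addrK mulrA. Qed.

Lemma ctl_conj p a u v : u * v = 1 -> GRing.comm p u ->
  u * ctl p a * v = ctl p (u * a * v).
Proof.
move=> uv pu; rewrite /ctl mulrDr mulr1 mulrDl uv; congr (1 + _).
rewrite mulrA -pu -!mulrA; congr (p * _).
by rewrite mulrBl mulrBr mul1r uv.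
Qed.

Lemma comm_ctl p a u : GRing.comm u p -> GRing.comm u a ->
  GRing.comm u (ctl p a).
Proof.
move=> up ua; apply: commrD; first exact: commr1.
by apply: commrM => //; apply: commrB => //; apply: commr1.
Qed.

(** Conjugation by [ctl p a] passes inside the control on [q], and conjugation by [b] inside the
    control on [p], so the four factors merge under two nested controls. *)
Lemma ctl_commutator p q a a' b b' :
  p * p = p -> q * q = q -> GRing.comm p q ->
  GRing.comm p a -> GRing.comm p a' -> GRing.comm p b -> GRing.comm p b' ->
  GRing.comm q a -> GRing.comm q a' -> GRing.comm q b -> GRing.comm q b' ->
  a * a' = 1 -> b * b' = 1 ->
  ctl p a * ctl q b * ctl p a' * ctl q b' = ctl (p * q) (a * b * a' * b').
Proof.
move=> pp qq pq pa pa' pb pb' qa qa' qb qb' aa bb.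
have uu : ctl p a * ctl p a' = 1 by rewrite -ctlM // aa ctl1.
have qu : GRing.comm q (ctl p a) by apply: comm_ctl.
have qu' : GRing.comm q (ctl p a') by apply: comm_ctl.
rewrite (@ctl_conj q b) // -ctlM //; last by apply/commrM => //; apply: commrM.
rewrite -!mulrA (mulrA b) (@ctl_conj p a' b) // -ctlM //.
by rewrite ctl_ctl pq !mulrA.
Qed.

End Controlled.

(** * Operators given by their coefficients *)

Section Kernels.
Variables (R : realType) (n d : nat).
Local Notation B := (basis n d).
Local Notation op := (qop R n d).
Implicit Types (K L : B -> B -> R[i]).

Lemma qop_of_ext K L : (forall x y, K x y = L x y) -> qop_of K = qop_of L.
Proof. by move=> KL; apply/matrixP=> a b; rewrite !mxE. Qed.

Lemma qop_ofM K L :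
  qop_of K * qop_of L = qop_of (fun x y => \sum_z K x z * L z y).
Proof.
apply/matrixP=> a b; rewrite !mxE [RHS](reindex (@enum_val _ predT)) /=.
  by apply: eq_bigr => c _; rewrite !mxE.
exact/onW_bij/enum_val_bij.
Qed.

Lemma qop_ofD K L : qop_of K + qop_of L = qop_of (fun x y => K x y + L x y).
Proof. by apply/matrixP=> a b; rewrite !mxE. Qed.

Lemma qop_ofN K : - qop_of K = qop_of (fun x y => - K x y).
Proof. by apply/matrixP=> a b; rewrite !mxE. Qed.

Lemma qop_of1 : qop_of (fun x y : B => (x == y)%:R) = 1 :> op.
Proof. by apply/matrixP=> a b; rewrite !mxE (inj_eq enum_val_inj). Qed.

Lemma qop_ofMdiag K (f : B -> R[i]) :
  qop_of K * qop_of (fun x y => (x == y)%:R * f y)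
  = qop_of (fun x y => K x y * f y).
Proof.
rewrite qop_ofM; apply: qop_of_ext => x y.
rewrite (bigD1 y) //= eqxx mul1r big1 ?addr0 // => z zy.
by rewrite (negPf zy) mul0r mulr0.
Qed.

Definition upd (x : B) (j : 'I_n) (v : 'I_d) : B :=
  [ffun k => if k == j then v else x k].

Definition agree (j : 'I_n) (x y : B) :=
  [forall k, (k != j) ==> (x k == y k)].

Lemma agreeP j (x y : B) :
  reflect (forall k, k != j -> x k = y k) (agree j x y).
Proof.
apply: (iffP forallP) => xy k; last by apply/implyP => /xy ->.
by move/(implyP (xy k))/eqP.
Qed.

Lemma local_gate1 j : local_gate j 1 = 1 :> op.
Proof.
rewrite -qop_of1; apply: qop_of_ext => x y; rewrite /local_coef -/(agree j x y).
rewrite mxE; case: agreeP => xy.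
  congr ((nat_of_bool _)%:R); apply/eqP/eqP => [xyj|->//].
  by apply/ffunP => k; case: (k =P j) => [->//|/eqP]; apply: xy.
by case: eqP => // xy'; case: xy => k _; rewrite xy'.
Qed.

Lemma local_gateM j (V W : 'M_d) :
  local_gate j (V *m W) = local_gate j V * local_gate j W :> op.
Proof.
rewrite qop_ofM; apply: qop_of_ext => x y.
rewrite /local_coef -/(agree j x y) mxE.
under [RHS]eq_bigr do rewrite -/(agree j _ _) -/(agree j _ _).
case: agreeP => xy; last first.
  rewrite big1 // => z _; case: agreeP => xz; last by rewrite mul0r.
  case: agreeP => zy; last by rewrite mulr0.
  by case: xy => k kj; rewrite xz // zy.
rewrite [RHS](bigID (agree j x)) /= [X in _ + X]big1 ?addr0; last first.
  by move=> z /negPf ->; rewrite mul0r.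
(* A vector [z] agreeing with [x] off [j] is determined by its entry at [j], so the sum over [z]
   becomes the sum of the matrix product. *)
rewrite (reindex_onto (upd x j) (fun z : B => z j)) /=; last first.
  move=> z /agreeP xz; apply/ffunP => k; rewrite ffunE.
  by case: eqP => [->//|/eqP /xz].
apply: eq_big => [k|k _].
  apply/esym/andP; split; last by rewrite ffunE eqxx.
  by apply/agreeP => l lj; rewrite ffunE (negPf lj).
have -> : agree j x (upd x j k).
  by apply/agreeP => l lj; rewrite ffunE (negPf lj).
have -> : agree j (upd x j k) y.
  by apply/agreeP => l lj; rewrite ffunE (negPf lj) xy.
by rewrite !ffunE eqxx.
Qed.

Lemma local_gateD j (V W : 'M_d) :
  local_gate j (V + W) = local_gate j V + local_gate j W :> op.
Proof.
rewrite qop_ofD; apply: qop_of_ext => x y; rewrite /local_coef mxE.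
by case: ifP => // _; rewrite addr0.
Qed.

(** Only one intermediate vector contributes: [x] with its entry at [i] taken from [y]. The
    resulting coefficient treats both gates symmetrically, whence [local_gate_comm]. *)
Lemma local_gateMC i j (V W : 'M_d) : i != j ->
  local_gate i V * local_gate j W
  = qop_of (fun x y => if [forall k, (k != i) && (k != j) ==> (x k == y k)]
      then V (x i) (y i) * W (x j) (y j) else 0) :> op.
Proof.
move=> ij; rewrite qop_ofM; apply: qop_of_ext => x y.
rewrite /local_coef; under eq_bigr do rewrite -/(agree i _ _) -/(agree j _ _).
case: ifPn => [/forallP xy | xy].
  rewrite (bigD1 (upd x i (y i))) //= big1 ?addr0; last first.
    move=> z zx; case: agreeP => xz; last by rewrite mul0r.
    case: agreeP => zy; last by rewrite mulr0.
    case/eqP: zx; apply/ffunP => k; rewrite ffunE.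
    by case: eqP => [->|/eqP ki]; [apply: zy | rewrite xz].
  have -> : agree i x (upd x i (y i)).
    by apply/agreeP => k ki; rewrite ffunE (negPf ki).
  have -> : agree j (upd x i (y i)) y.
    apply/agreeP => k kj; rewrite ffunE; case: eqP => [->//|/eqP ki].
    by apply/eqP; have:= xy k; rewrite ki kj.
  by rewrite !ffunE eqxx [j == i]eq_sym (negPf ij).
rewrite big1 // => z _; case: agreeP => xz; last by rewrite mul0r.
case: agreeP => zy; last by rewrite mulr0.
case/negP: xy; apply/forallP => k; apply/implyP => /andP[ki kj].
by rewrite xz // zy.
Qed.

Lemma local_gate_comm i j (V W : 'M_d) : i != j ->
  GRing.comm (local_gate i V : op) (local_gate j W).
Proof.
move=> ij; rewrite /GRing.comm !local_gateMC // 1?eq_sym //.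
apply: qop_of_ext => x y.
by under eq_forallb do rewrite andbC; rewrite mulrC.
Qed.

Definition proj (S : {set 'I_n}) : op :=
  qop_of (fun x y => (x == y)%:R * [forall i in S, (y i).+1 == d :> nat]%:R).

Definition last_mx : 'M[R[i]]_d := \matrix_(i, j) ((i == j) && (j.+1 == d :> nat))%:R.

Lemma proj0 : proj set0 = 1.
Proof.
rewrite -qop_of1; apply: qop_of_ext => x y.
case: forallP => [_|[]]; first by rewrite mulr1.
by move=> i; rewrite inE.
Qed.

Lemma projU S T : proj (S :|: T) = proj S * proj T.
Proof.
rewrite qop_ofMdiag; apply: qop_of_ext => x y; rewrite -mulrA.
congr (_ * _); rewrite -natrM mulnb; congr ((nat_of_bool _)%:R).
apply/forallP/andP => [H|[/forallP H1 /forallP H2] i].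
  split; apply/forallP => i; apply/implyP => iS; apply: (implyP (H i));
  by rewrite inE iS ?orbT.
by apply/implyP; rewrite inE => /orP[] ii;
  [apply: (implyP (H1 i)) | apply: (implyP (H2 i))].
Qed.

Lemma proj_set1 i : proj [set i] = local_gate i last_mx.
Proof.
apply: qop_of_ext => x y; rewrite /local_coef -/(agree i x y) mxE -natrM mulnb.
have -> : [forall j in [set i], (y j).+1 == d :> nat] = ((y i).+1 == d :> nat).
  apply/forallP/idP => [H|H j]; first by apply: (implyP (H i)); rewrite inE.
  by apply/implyP; rewrite inE => /eqP ->.
case: agreeP => xy.
  congr (nat_of_bool (_ && _))%:R; apply/eqP/eqP => [->//|xyi].
  by apply/ffunP => k; case: (k =P i) => [->//|/eqP]; apply: xy.
by case: eqP => // xy'; case: xy => k _; rewrite xy'.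
Qed.

Lemma projK S : proj S * proj S = proj S.
Proof. by rewrite -projU setUid. Qed.

(** As [proj] turns unions into products, [proj S] is a product of one-factor projections over an
    enumeration of [S]. *)
Lemma proj_ind (S : {set 'I_n}) (P : op -> Prop) : P 1 ->
  (forall i Q, i \in S -> P Q -> P (local_gate i last_mx * Q)) -> P (proj S).
Proof.
move=> P1 PM; have: forall s : seq 'I_n, {subset s <= S} -> P (proj [set x in s]).
  elim=> [|i s IH] sS; first by rewrite set_nil proj0.
  rewrite set_cons projU proj_set1; apply: PM; first by rewrite sS ?mem_head.
  by apply: IH => j js; rewrite sS // inE js orbT.
move=> /(_ (enum S)); rewrite set_enum; apply=> i.
by rewrite mem_enum.
Qed.

Lemma comm_proj (S : {set 'I_n}) (K : op) :
  (forall i, i \in S -> GRing.comm K (local_gate i last_mx)) ->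
  GRing.comm K (proj S).
Proof.
move=> KS; apply: (proj_ind (P := GRing.comm K)); first exact: commr1.
by move=> i Q iS KQ; apply: commrM => //; apply: KS.
Qed.

Lemma comm_proj_local (S : {set 'I_n}) j V : j \notin S ->
  GRing.comm (proj S) (local_gate j V).
Proof.
move=> jS; apply/commr_sym/comm_proj => i iS; apply: local_gate_comm.
by apply: contraNneq jS => ->.
Qed.

Lemma ctrl_gateE (S : {set 'I_n}) j V : j \notin S ->
  ctrl_gate S j V = ctl (proj S) (local_gate j V).
Proof.
move=> jS; rewrite /ctl.
(* [ctrl_gate] tests the controls on the column index [y], so the projection has to stand on the
   right, where it acts on columns. *)
have -> : proj S * (local_gate j V - 1) = (local_gate j V - 1) * proj S.
  by apply: commrB; [apply: comm_proj_local | apply: commr1].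
rewrite -qop_of1 qop_ofN qop_ofD qop_ofMdiag qop_ofD; apply: qop_of_ext => x y.
by case: [forall _ in _, _]; rewrite ?mulr1 ?mulr0 ?addr0 // addrC subrK.
Qed.

End Kernels.

(** * Unitary matrices and the cyclic shift *)

Section UnitaryMatrices.
Variables (C : numClosedFieldType) (p : nat).
Local Notation d := p.+2.
Implicit Types (A U P Q : 'M[C]_d) (s : C).

Lemma unitary_unit A : A \is unitarymx -> A \is a GRing.unit.
Proof. exact: unitarymx_unit. Qed.

Lemma unitary_mulmxV A : A \is unitarymx -> A * A^-1 = 1.
Proof. by move/unitary_unit/divrr. Qed.

Lemma unitary_mulVmx A : A \is unitarymx -> A^-1 * A = 1.
Proof. by move/unitary_unit/mulVr. Qed.

Lemma scale_mulmxl s A U : (s *: A) * U = s *: (A * U).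
Proof. by rewrite -!mulmxE -scalemxAl. Qed.

Lemma scale_mulmxr s A U : A * (s *: U) = s *: (A * U).
Proof. by rewrite -!mulmxE -scalemxAr. Qed.

Lemma unitary1 : (1 : 'M[C]_d) \is unitarymx.
Proof. by apply/unitarymxP; rewrite trmx1 map_mx1 mulmx1. Qed.

Lemma unitaryM A U : A \is unitarymx -> U \is unitarymx -> A * U \is unitarymx.
Proof. exact: mul_unitarymx. Qed.

Lemma unitaryV A : A \is unitarymx -> A^-1 \is unitarymx.
Proof.
by move=> uA; rewrite -[A^-1]/(invmx A) invmx_unitary // trmxC_unitary.
Qed.

Lemma unitaryZ s A : `|s| = 1 -> A \is unitarymx -> s *: A \is unitarymx.
Proof.
move=> s1 /unitarymxP uA; apply/unitarymxP; rewrite linearZ /= map_mxZ.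
by rewrite -scalemxAl -scalemxAr uA scalerA -normCK s1 expr1n scale1r.
Qed.

Lemma commutatorZ (s t : C) P Q : `|s| = 1 -> `|t| = 1 ->
  P \is unitarymx -> Q \is unitarymx ->
  (s *: P) * (t *: Q) * (s *: P)^-1 * (t *: Q)^-1 = P * Q * P^-1 * Q^-1.
Proof.
move=> s1 t1 uP uQ; have us : s \is a GRing.unit by rewrite unitfE -normr_gt0 s1.
have ut : t \is a GRing.unit by rewrite unitfE -normr_gt0 t1.
rewrite !invrZ ?unitary_unit // !(scale_mulmxl, scale_mulmxr) !scalerA.
by rewrite mulrVK // divrr // scale1r.
Qed.

Lemma unitary_diag (v : 'rV[C]_d) :
  (diag_mx v \is unitarymx) = [forall i, `|v 0 i| == 1].
Proof.
have E : diag_mx v *m ((diag_mx v)^t*)%sesqui = diag_mx (\row_i (`|v 0 i| ^+ 2)).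
  rewrite tr_diag_mx map_diag_mx mulmx_diag; congr diag_mx.
  by apply/rowP => i; rewrite !mxE -normCK.
apply/unitarymxP/forallP; rewrite E => H.
  move=> i; move/matrixP/(_ i i): H; rewrite !mxE eqxx mulr1n => /eqP.
  by rewrite sqrp_eq1.
by apply/matrixP => i j; rewrite !mxE (eqP (H i)) expr1n.
Qed.

Lemma perm_mx_unitary (s : 'S_d) : perm_mx s \is (@unitarymx C d d).
Proof.
apply/unitarymxP; rewrite tr_perm_mx map_perm_mx -perm_mxM mulgV.
exact: perm_mx1.
Qed.

Lemma norm_det_unitary A : A \is unitarymx -> `|\det A| = 1.
Proof.
move/unitarymxP/(congr1 determinant); rewrite det1 det_mulmx det_map_mx det_tr.
by rewrite -normCK => /eqP; rewrite sqrp_eq1 // => /eqP.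
Qed.

Lemma unitary_diagonalize U : U \is unitarymx ->
  exists A (v : 'rV_d), [/\ A \is unitarymx, diag_mx v \is unitarymx
    & U = A * diag_mx v * A^-1].
Proof.
move=> uU; have: U \is normalmx.
  apply/normalmxP; rewrite (unitarymxP uU) -invmx_unitary //.
  by rewrite mulVmx // unitarymx_unit.
move/orthomx_spectralP; set P := spectralmx U; set v := spectral_diag U => E.
have uP : P \is unitarymx by apply: spectral_unitarymx.
exists P^-1, v; rewrite invrK; split => //; first exact: unitaryV.
suff -> : diag_mx v = P * U * P^-1.
  by rewrite !unitaryM ?unitaryV.
rewrite {1}E -[invmx P]/(P^-1) -!mulmxE -!mulmxA !mulmxE.
by rewrite !mulrA (unitary_mulmxV uP) mul1r -mulrA (unitary_mulmxV uP) mulr1.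
Qed.

Lemma scaled_to_SU A : A \is unitarymx ->
  exists2 s, `|s| = 1 & \det (s *: A) = 1.
Proof.
move=> /norm_det_unitary dA; have dA0 : \det A != 0 by rewrite -normr_gt0 dA.
exists (d.-root (\det A)^-1); last by rewrite detZ rootCK // mulVf.
apply/eqP; rewrite -(@pexpr_eq1 _ _ d) // -normrX rootCK //.
by rewrite normfV dA invr1.
Qed.

Lemma diag_inv (v : 'rV[C]_d) : diag_mx v \is unitarymx ->
  (diag_mx v)^-1 = diag_mx (\row_i (v 0 i)^-1).
Proof.
move=> uv; apply: (mulrI (unitary_unit uv)); rewrite (unitary_mulmxV uv).
rewrite -mulmxE mulmx_diag; apply/matrixP => i j; rewrite !mxE.
rewrite unitary_diag in uv; rewrite divff // -normr_eq0.
by rewrite (eqP (forallP uv i)) oner_eq0.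
Qed.

End UnitaryMatrices.

(** * Conjugates of the cyclic shift and commutators in SU(d) *)

Section Shift.
Variables (C : numClosedFieldType) (p : nat).
Local Notation d := p.+2.
Implicit Types (A U P Q : 'M[C]_d) (s : C).

Lemma val_ordS (i : 'I_d) : ordS i = (if i.+1 == d then 0 else i.+1)%N :> nat.
Proof.
rewrite /=; case: eqP => [->|]; first by rewrite modnn.
by have := ltn_ord i => ? ?; rewrite modn_small //; lia.
Qed.

Lemma val_ord_pred (i : 'I_d) :
  ord_pred i = (if i == 0%N :> nat then p.+1 else i.-1)%N :> nat.
Proof.
rewrite /=; case: eqP => [->|i0]; first by rewrite add0n modn_small.
have := ltn_ord i => ?; have -> : ((i + d).-1 = i.-1 + d)%N by lia.
by rewrite modnDr modn_small //; lia.
Qed.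

Definition cyclic_mx : 'M[C]_d :=
  \matrix_(b < d, a < d) (b == a.+1 %% d :> nat)%N%:R.
Local Notation X := cyclic_mx.

Lemma cyclic_mxE : X = perm_mx (perm (@ord_pred_inj d)).
Proof.
apply/matrixP => b a; rewrite !mxE permE; congr (nat_of_bool _)%:R.
rewrite -(inj_eq (@ordS_inj d)) ord_predK -val_eqE /=.
by [].
Qed.

Lemma cyclic_mx_unitary : X \is unitarymx.
Proof. by rewrite cyclic_mxE perm_mx_unitary. Qed.

Definition rev_mx : 'M[C]_d := perm_mx (perm (@rev_ord_inj d)).

(* X^-1 = J X J with J the reversal of the levels, so the inverse of a CINC
   gate costs one CINC gate. *)
Lemma cyclic_rev : X * (rev_mx * X * rev_mx) = 1.
Proof.
rewrite cyclic_mxE -!mulmxE -!perm_mxM; apply/matrixP=> i j; rewrite !mxE.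
congr (nat_of_bool (_ == _))%:R; rewrite !permM !permE; apply/val_inj.
have := val_ord_pred i; move: (ord_pred i) => a Ea.
have := val_ord_pred (rev_ord a); move: (ord_pred _) => b /= Eb.
have := ltn_ord i; have := ltn_ord a; have := ltn_ord b.
by move: Ea Eb; case: ifP => Hi; case: ifP => Hj; lia.
Qed.

Lemma cyclic_diag (v w : 'rV[C]_d) : (forall a, w 0 (ordS a) = v 0 a) ->
  X * diag_mx v = diag_mx w * X.
Proof.
move=> vw; rewrite -mulmxE mul_mx_diag mul_diag_mx; apply/matrixP => b a.
rewrite !mxE; case: eqP => /= [E|]; last by rewrite mul0r mulr0.
have -> : b = ordS a by apply: val_inj.
by rewrite vw mulrC.
Qed.

Lemma cyclic_mxX k : X ^+ k = \matrix_(b, a) (b == iter k (@ordS d) a)%:R.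
Proof.
elim: k => [|k IH]; first by apply/matrixP => i j; rewrite !mxE.
apply/matrixP => i j; rewrite exprS IH -mulmxE !mxE.
rewrite (bigD1 (iter k (@ordS d) j)) //= big1 ?addr0 => [|a aj].
  by rewrite !mxE eqxx mulr1 /=; congr (nat_of_bool _)%:R; rewrite -val_eqE.
by rewrite !mxE (negPf aj) mulr0.
Qed.

Lemma cyclic_mx_order : X ^+ d = 1.
Proof.
rewrite cyclic_mxX; apply/matrixP => i j; rewrite !mxE.
suff -> : iter d (@ordS d) j = j by [].
have E k : iter k (@ordS d) j = ((j + k) %% d)%N :> nat.
  elim: k => [|k IH]; first by rewrite addn0 modn_small.
  by rewrite iterS /= IH -addn1 modnDml -addnA addn1.
by apply: val_inj; apply: (etrans (E d)); rewrite modnDr modn_small.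
Qed.

(** The partial products of [v] solve the recursion; it closes up when the cycle returns to level 0
    because the full product is 1. *)
Lemma cyclic_cocycle (v : 'rV[C]_d) :
  (forall i, `|v 0 i| = 1) -> \prod_i v 0 i = 1 ->
  exists w : 'rV[C]_d, (forall i, `|w 0 i| = 1) /\
    (forall a, w 0 (ordS a) = v 0 (ordS a) * w 0 a).
Proof.
move=> nv pv; pose f k := \prod_(j < d | (j <= k)%N) v 0 j.
have fS (i : 'I_d) : (0 < i)%N -> f i = v 0 i * f i.-1.
  move=> i0; rewrite /f (bigD1 i) //=; congr (_ * _); apply: eq_bigl => j.
  by rewrite -val_eqE /=; lia.
exists (\row_i f i); split => [i|a]; rewrite !mxE.
  by rewrite normr_prod big1.
have := val_ordS a; move: (ordS a) => b; case: eqP => [ad Sa|ad Sa].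
  have -> : f a = 1.
    rewrite -pv; apply: eq_bigl => j; have := ltn_ord j; lia.
  rewrite mulr1 /f (bigD1 b) ?leqnn //= big1 ?mulr1 // => j.
  by rewrite -val_eqE /= Sa; lia.
by rewrite fS Sa.
Qed.

Definition shift_like P :=
  exists A s, [/\ A \is unitarymx, `|s| = 1 & P = s *: (A * X * A^-1)].

Lemma shift_like_unitary P : shift_like P -> P \is unitarymx.
Proof.
case=> A [s [uA s1 ->]]; apply: unitaryZ => //.
by rewrite !unitaryM ?unitaryV // cyclic_mx_unitary.
Qed.

Lemma shift_like_conj P A : A \is unitarymx -> shift_like P ->
  shift_like (A * P * A^-1).
Proof.
move=> uA [B [s [uB s1 ->]]]; exists (A * B), s; split=> //.
  exact: unitaryM.
by rewrite scale_mulmxr scale_mulmxl invrM ?unitary_unit // !mulrA.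
Qed.

Lemma shift_likeZ P s : `|s| = 1 -> shift_like P -> shift_like (s *: P).
Proof.
move=> s1 [B [t [uB t1 ->]]]; exists B, (s * t); split=> //.
  by rewrite normrM s1 t1 mulr1.
by rewrite scalerA.
Qed.

(** Conjugating X by a diagonal [w] multiplies it by the quotients of cyclically consecutive entries
    of [w]. These can be any phases of product 1, so [q] is first divided by a d-th root [m] of its
    product. *)
Lemma diag_shift_like (q : 'rV[C]_d) : diag_mx q \is unitarymx ->
  shift_like (diag_mx q * X).
Proof.
move=> uq; have := uq; rewrite unitary_diag => /forallP nq.
pose m := d.-root (\prod_i q 0 i).
have m1 : `|m| = 1.
  apply/eqP; rewrite -(@pexpr_eq1 _ _ d) // -normrX rootCK //.
  by rewrite normr_prod big1 // => i _; apply/eqP.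
have m0 : m != 0 by rewrite -normr_gt0 m1.
have [|| w [nw ww]] := @cyclic_cocycle (\row_i (q 0 i / m)).
- by move=> i; rewrite mxE normrM normfV m1 (eqP (nq i)) divr1.
- under eq_bigr do rewrite mxE.
  rewrite prodf_div prodr_const card_ord rootCK // divff //.
  by rewrite -normr_gt0 -[\prod_i _](@rootCK C d) // normrX m1 expr1n.
have uw : diag_mx w \is unitarymx.
  by rewrite unitary_diag; apply/forallP => i; rewrite nw.
exists (diag_mx w), m; split=> //.
apply: (mulIr (unitary_unit uw)).
rewrite scale_mulmxl -!mulrA (unitary_mulVmx uw) mulr1.
rewrite (@cyclic_diag w (\row_i w 0 (ord_pred i))); last first.
  by move=> a; rewrite mxE ordSK.
rewrite mulrA -scale_mulmxl; congr (_ * _); rewrite -mulmxE mulmx_diag.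
apply/matrixP => i j; rewrite !mxE mulrnAr; congr (_ *+ _).
rewrite -(ord_predK i) ww mxE !ord_predK; move: (w 0 _) => y.
by rewrite mulrA [m * _]mulrC divfK.
Qed.

Lemma SU_commutator U : U \is unitarymx -> \det U = 1 ->
  exists P Q, [/\ shift_like P, shift_like Q, \det P = 1, \det Q = 1
    & U = P * Q * P^-1 * Q^-1].
Proof.
move=> uU dU; have [A [v [uA uv EU]]] := unitary_diagonalize uU.
have := uv; rewrite unitary_diag => /forallP nv.
have uX := cyclic_mx_unitary.
(* A diagonal q with v = X q X^-1 q^-1 must satisfy q(a+1) = v(a+1)^-1 q(a). The product condition
   holds because the eigenvalues of [U] multiply to its determinant 1. *)
have [||q [nq qq]] := @cyclic_cocycle (\row_i (v 0 i)^-1).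
- by move=> i; rewrite mxE normfV (eqP (nv i)) invr1.
- under eq_bigr do rewrite mxE.
  rewrite prodfV -det_diag.
  have -> : diag_mx v = A^-1 * U * A.
    by rewrite EU !mulrA (unitary_mulVmx uA) mul1r -mulrA (unitary_mulVmx uA) mulr1.
  rewrite -!mulmxE !det_mulmx dU mulr1 -det_mulmx mulmxE.
  by rewrite (unitary_mulVmx uA) det1 invr1.
have uq : diag_mx q \is unitarymx.
  by rewrite unitary_diag; apply/forallP => i; rewrite nq.
have Ev : diag_mx v = X * diag_mx q * X^-1 * (diag_mx q)^-1.
  rewrite (@cyclic_diag q (\row_i (v 0 i * q 0 i))) => [|a]; last first.
    rewrite !mxE qq mxE mulrA divff ?mul1r //.
    by rewrite -normr_gt0 (eqP (nv _)).
  have -> : diag_mx (\row_i (v 0 i * q 0 i)) = diag_mx v * diag_mx q.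
    by rewrite -mulmxE mulmx_diag.
  by rewrite -!mulrA (mulrA X) (unitary_mulmxV uX) mul1r (unitary_mulmxV uq) mulr1.
(* Replacing q by q X does not change its commutator with X, and makes the second factor
   shift-like. *)
pose P := A * X * A^-1; pose Q := A * (diag_mx q * X) * A^-1.
have lP : shift_like P.
  exists A, 1; split; [exact: uA | exact: normr1 | by rewrite scale1r].
have lQ : shift_like Q by apply/shift_like_conj => //; apply: diag_shift_like.
have [uP uQ] := (shift_like_unitary lP, shift_like_unitary lQ).
(* Phases normalise both determinants to 1 and cancel in the commutator. *)
have [s s1 ds] := scaled_to_SU uP; have [t t1 dt] := scaled_to_SU uQ.
exists (s *: P), (t *: Q); split=> //; try exact: shift_likeZ.
rewrite commutatorZ // EU Ev /P /Q.
rewrite !invrM ?unitary_unit ?unitaryM ?unitaryV // !invrK !mulrA.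
by rewrite !(mulrVK, mulrK) ?unitary_unit.
Qed.

End Shift.

(** * Level projections and phase gates *)

Section MoreMatrices.
Variables (C : numClosedFieldType) (p : nat).
Local Notation d := p.+2.
Local Notation X := (cyclic_mx C p).

Definition level_mx (i : 'I_d) : 'M[C]_d := diag_mx (delta_mx 0 i).

(** This is the diagonal matrix with [s] at level d - 1 and 1 elsewhere; the form with [ctl] lets
    [ctl_ctl] read it as a scalar under one more control. *)
Definition phase_mx (s : C) : 'M[C]_d := ctl (level_mx ord_max) s%:M.

Lemma phase_mx_unitary s : `|s| = 1 -> phase_mx s \is unitarymx.
Proof.
move=> s1; have -> : phase_mx s = diag_mx (\row_i if i == ord_max then s else 1).
  rewrite /phase_mx /ctl -mulmxE mul_diag_mx; apply/matrixP => i j; rewrite !mxE.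
  rewrite eqxx /=; case: (i == j); case: (i == _) => /=.
  - by rewrite !mulr1n mul1r addrC subrK.
  - by rewrite !mulr1n mul0r addr0.
  - by rewrite !mulr0n subr0 mulr0 addr0.
  - by rewrite !mulr0n mul0r addr0.
rewrite unitary_diag; apply/forallP => i; rewrite mxE.
by case: ifP => _; rewrite ?s1 ?normr1.
Qed.

Lemma sum_level_mx : \sum_i level_mx i = 1.
Proof.
apply/matrixP => i j; rewrite summxE (bigD1 i) //= big1 => [|k ki].
  by rewrite !mxE !eqxx addr0.
by rewrite !mxE eqxx [i == k]eq_sym (negPf ki) mul0rn.
Qed.

Lemma level_mxM i j : level_mx i * level_mx j = if i == j then level_mx i else 0.
Proof.
rewrite /level_mx -mulmxE mulmx_diag; case: eqP => [->|ij].
  by congr (diag_mx _); apply/rowP => k; rewrite !mxE -natrM mulnb andbb.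
apply/matrixP => k l; rewrite !mxE eqxx /= -natrM mulnb.
case: (_ =P i) => [->|_]; last by rewrite mul0rn.
by rewrite (negPf (introN eqP ij)) mul0rn.
Qed.

Lemma diag_mx_comm (v w : 'rV[C]_d) : GRing.comm (diag_mx v) (diag_mx w).
Proof.
rewrite /GRing.comm -!mulmxE !mulmx_diag; congr (diag_mx _).
by apply/rowP => i; rewrite !mxE mulrC.
Qed.

Lemma cyclic_level i : X * level_mx i = level_mx (ordS i) * X.
Proof. by apply: cyclic_diag => a; rewrite !mxE (inj_eq (@ordS_inj d)). Qed.

(** Swapping levels [i] and d - 1 by a single-qudit gate lets a control fire at any level for the
    same number of CINC gates. *)
Lemma level_mx_conj i : exists2 T : 'M[C]_d, T \is unitarymx &
  level_mx i = T * level_mx ord_max * T^-1.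
Proof.
have uT : perm_mx (tperm i (@ord_max p.+1)) \is (@unitarymx C d d).
  exact: perm_mx_unitary.
exists (perm_mx (tperm i ord_max)) => //.
apply: (mulIr (unitary_unit uT)).
rewrite -[RHS]mulrA (unitary_mulVmx uT) mulr1 -!mulmxE mul_diag_mx mul_mx_diag.
apply/matrixP => k l; rewrite !mxE /=.
case: (_ =P l) => [<-|]; last by rewrite mul0r mulr0.
by rewrite -[k == i](inj_eq (@perm_inj _ (tperm i ord_max))) tpermL mulrC.
Qed.

Lemma conj_cyclic_order (Y Z : 'M[C]_d) : Y \is unitarymx ->
  Y * Z * Y^-1 = X -> Z ^+ d = 1.
Proof.
move=> uY EX; have E k : Y * Z ^+ k = X ^+ k * Y.
  elim: k => [|k IH]; first by rewrite !expr0 mulr1 mul1r.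
  rewrite exprSr mulrA IH exprSr -!mulrA; congr (_ * _).
  by rewrite -EX -!mulrA (unitary_mulVmx uY) mulr1.
by apply: (mulrI (unitary_unit uY)); rewrite E cyclic_mx_order mul1r mulr1.
Qed.

End MoreMatrices.

(** * Block-diagonal elements over orthogonal idempotents *)

Section Selectors.
Variables (A : pzRingType) (I : finType) (e : I -> A).
Hypotheses (eM : forall i j, e i * e j = if i == j then e i else 0)
  (e1 : \sum_i e i = 1).

Definition select (y : I -> A) := \sum_i e i * y i.

Lemma selectM (y z : I -> A) : (forall i j, GRing.comm (e i) (y j)) ->
  select y * select z = select (fun i => y i * z i).
Proof.
move=> ey; rewrite /select mulr_suml; apply: eq_bigr => i _.
rewrite mulr_sumr (bigD1 i) //= big1 ?addr0 => [|j ji].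
  by rewrite -mulrA (mulrA (y i)) -ey !mulrA eM eqxx.
by rewrite -mulrA (mulrA (y i)) -ey !mulrA eM eq_sym (negPf ji) !mul0r.
Qed.

Lemma select1 : select (fun=> 1) = 1.
Proof. by rewrite /select; under eq_bigr do rewrite mulr1. Qed.

Lemma comm_select (y : I -> A) (u : A) :
  (forall i, GRing.comm u (e i)) -> (forall i, GRing.comm u (y i)) ->
  GRing.comm u (select y).
Proof. by move=> ue uy; apply: commr_sum => i _; apply: commrM. Qed.

(** Orthogonality kills all cross terms, so the product is 1 plus the sum of the [e i * (y i - 1)];
    the 1 is absorbed through [e1]. *)
Lemma prod_ctl_select (y : I -> A) : (forall i j, GRing.comm (e i) (y j)) ->
  \prod_i ctl (e i) (y i) = select y.
Proof.
move=> ey.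
have H (s : seq I) : uniq s ->
    \prod_(i <- s) ctl (e i) (y i) = 1 + \sum_(i <- s) e i * (y i - 1).
  elim: s => [|i s IH] /=; first by rewrite !big_nil addr0.
  case/andP=> is_ us; rewrite !big_cons IH // /ctl mulrDl mul1r -addrA.
  congr (1 + _); rewrite [_ * (1 + _)]mulrDr mulr1 mulr_sumr.
  rewrite [X in _ + (_ + X)]big1_seq ?addr0; last first.
    move=> j /= js; have ij : i != j by apply: contraNneq is_ => ->.
    rewrite -mulrA (mulrA (y i - 1)).
    have eyj : GRing.comm (e j) (y i - 1).
      by apply: commrB; [apply: ey | apply: commr1].
    by rewrite -eyj !mulrA eM (negPf ij) !mul0r.
  by rewrite addrC.
rewrite H ?index_enum_uniq // /select -{1}e1 -big_split /=.
by apply: eq_bigr => i _; rewrite mulrBr mulr1 addrC subrK.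
Qed.

End Selectors.

(** * Synthesis over an abstract circuit model *)

(* loc j V is V on the j-th factor, pro S the projection onto the basis vectors
   that are d - 1 at every factor in S, and synth g N says that g is a circuit
   with at most N CINC gates; d is p.+2. *)
Record circuit_model (C : numClosedFieldType) (n p : nat) := CircuitModel {
  op_ring :> pzRingType;
  loc : 'I_n -> 'M[C]_p.+2 -> op_ring;
  pro : {set 'I_n} -> op_ring;
  synth : op_ring -> int -> Prop;
  loc1 : forall j, loc j 1 = 1;
  locM : forall j V W, loc j (V * W) = loc j V * loc j W;
  locD : forall j V W, loc j (V + W) = loc j V + loc j W;
  loc_scalar : forall i j s, loc i s%:M = loc j s%:M;
  loc_comm : forall i j V W, i != j -> GRing.comm (loc i V) (loc j W);
  pro0 : pro set0 = 1;
  proU : forall S T, pro (S :|: T) = pro S * pro T;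
  pro1 : forall i, pro [set i] = loc i (level_mx C ord_max);
  comm_pro : forall (S : {set 'I_n}) (a : op_ring),
    (forall i, i \in S -> GRing.comm a (loc i (level_mx C ord_max))) ->
    GRing.comm a (pro S);
  synth_loc : forall j V, V \is unitarymx -> synth (loc j V) 0;
  synth_cinc : forall i t, i != t ->
    synth (ctl (pro [set i]) (loc t (cyclic_mx C p))) 1;
  synthM : forall a b N K, synth a N -> synth b K -> synth (a * b) (N + K);
  synth_le : forall a N K, synth a N -> N <= K -> synth a K;
  synth_inv : forall a N, synth a N -> exists2 b, a * b = 1 & synth b N }.

(** The count is piecewise linear with matching values at powers of two, so the formula for [k]
    stays valid at the right end, where the logarithm already jumps. This lets both halves of a
    splitting share one [k]. *)
Lemma N_SU_recE k c : (2 ^ k <= c <= 2 ^ k.+1)%N ->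
  N_SU_rec c.+1 = 2 ^+ (2 * k) + 3 * 2 ^+ k * (c%:Z - 2 ^+ k).
Proof.
have cS : c.+1%:Z = c%:Z + 1 by rewrite -addn1 PoszD.
case/andP=> kc; rewrite leq_eqVlt => /orP[/eqP Ec|ck]; rewrite /N_SU_rec /= cS.
  have -> : trunc_log 2 c = k.+1 by rewrite Ec trunc_expnK.
  rewrite Ec -(natz (2 ^ _)) natrX mulnS exprD !exprS.
  rewrite mulnC exprM. ring.
rewrite (@trunc_log_eq 2 k c) ?kc //; ring.
Qed.

(** With 2^k <= [c./2] < 2^(k+1), [uphalf c] is at most 2^(k+1) and [c] lies in the interval for k +
    1, so the identity reduces to linear formulas. *)
Lemma N_SU_rec_half c : (2 <= c)%N ->
  N_SU_rec c.+1 = N_SU_rec c./2.+1 + N_SU_rec (uphalf c).+1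
                + N_SU_rec c./2.+1 + N_SU_rec (uphalf c).+1.
Proof.
move=> c2; have h0 : (0 < c./2)%N by lia.
have /andP[] := @trunc_log_bounds 2 _ isT h0; set k := trunc_log 2 _ => k1 k2.
have E := odd_double_half c; have U := uphalf_half c.
rewrite (@N_SU_recE k.+1) ?(@N_SU_recE k c./2) ?(@N_SU_recE k (uphalf c));
  try by rewrite !expnS in k1 k2 *; lia.
have -> : c%:Z = (c./2)%:Z + (uphalf c)%:Z by rewrite -PoszD; congr Posz; lia.
rewrite mulnS exprD !exprS mulnC exprM; ring.
Qed.

Lemma exists_subset_card (T : finType) (S : {set T}) k : (k <= #|S|)%N ->
  exists2 S' : {set T}, S' \subset S & #|S'| = k.
Proof.
move=> kS; exists [set x in take k (enum S)].
  apply/subsetP => x; rewrite inE => /mem_take.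
  by rewrite mem_enum.
rewrite cardsE (card_uniqP _) ?take_uniq ?enum_uniq // size_takel //.
by rewrite -cardE.
Qed.

Section Synthesis.
Variables (C : numClosedFieldType) (n p : nat) (M : circuit_model C n p).
Local Notation d := p.+2.
Local Notation X := (cyclic_mx C p).
Local Notation E := (level_mx C (@ord_max p.+1)).
Local Notation loc := (loc M).
Local Notation pro := (pro M).
Local Notation synth := (@synth _ _ _ M).
Implicit Types (S T A F : {set 'I_n}) (V W U P Q : 'M[C]_d) (i j t x a b : 'I_n).

Lemma loc0 j : loc j 0 = 0.
Proof. by apply: (addrI (loc j 0)); rewrite -locD !addr0. Qed.

Lemma locN j V : loc j (- V) = - loc j V.
Proof. by apply: (addrI (loc j V)); rewrite -locD !subrr loc0. Qed.

Lemma loc_ctl j V W : loc j (ctl V W) = ctl (loc j V) (loc j W).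
Proof. by rewrite /ctl locD locM locD locN !loc1. Qed.

Lemma locK j V : V \is unitarymx -> loc j V * loc j V^-1 = 1.
Proof. by move=> uV; rewrite -locM (unitary_mulmxV uV) loc1. Qed.

Lemma locVK j V : V \is unitarymx -> loc j V^-1 * loc j V = 1.
Proof. by move=> uV; rewrite -locM (unitary_mulVmx uV) loc1. Qed.

Lemma locC j V W : GRing.comm V W -> GRing.comm (loc j V) (loc j W).
Proof. by move=> VW; rewrite /GRing.comm -!locM VW. Qed.

Lemma proK S : pro S * pro S = pro S.
Proof. by rewrite -proU setUid. Qed.

Lemma proC S T : GRing.comm (pro S) (pro T).
Proof. by rewrite /GRing.comm -!proU setUC. Qed.

Lemma pro_comm S t V : t \notin S -> GRing.comm (pro S) (loc t V).
Proof.
move=> tS; apply/commr_sym/comm_pro => i iS; apply: loc_comm.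
by apply: contraNneq tS => ->.
Qed.

Lemma pro_comm_diag S t (v : 'rV_d) : GRing.comm (pro S) (loc t (diag_mx v)).
Proof.
apply/commr_sym/comm_pro => i iS.
case: (eqVneq t i) => [->|]; last exact: loc_comm.
by apply: locC; apply: diag_mx_comm.
Qed.

(** The inverse supplied by the model has a right inverse as well, hence is two-sided and equals
    [h]. *)
Lemma synthV (g h : M) N : synth g N -> g * h = 1 -> synth h N.
Proof.
move=> sg gh; have [g' gg' sg'] := synth_inv sg.
have [g'' g'g'' _] := synth_inv sg'.
have g'g : g' * g = 1 by rewrite -[g]mulr1 -{1}g'g'' (mulrA g) gg' mul1r.
by rewrite -[h]mul1r -g'g -mulrA gh mulr1.
Qed.

Lemma synth1 : forall N, 0 <= N -> 'I_n -> synth 1 N.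
Proof.
move=> N N0 j; apply: (synth_le _ N0); rewrite -(loc1 M j).
by apply: synth_loc; apply: unitary1.
Qed.

Lemma synth_conj j V (g : M) N : V \is unitarymx -> synth g N ->
  synth (loc j V * g * loc j V^-1) N.
Proof.
move=> uV gN; rewrite -[N]addr0 -[N]add0r.
by do 2?[apply: synthM => //]; apply: synth_loc; rewrite ?unitaryV.
Qed.

Definition csynth S t V N := synth (ctl (pro S) (loc t V)) N.

Lemma csynth_le S t V N K : csynth S t V N -> N <= K -> csynth S t V K.
Proof. exact: synth_le. Qed.

Lemma csynthM S t V W N K : t \notin S ->
  csynth S t V N -> csynth S t W K -> csynth S t (V * W) (N + K).
Proof.
move=> tS sV sW; rewrite /csynth locM ctlM ?proK //; last exact: pro_comm.
exact: synthM.
Qed.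

Lemma csynthV S t V N : t \notin S -> V \is unitarymx ->
  csynth S t V N -> csynth S t V^-1 N.
Proof.
move=> tS uV sV; apply: (synthV sV); rewrite -ctlM ?proK //.
  by rewrite locK // ctl1.
exact: pro_comm.
Qed.

Lemma csynth_conj S t V W N : t \notin S -> W \is unitarymx ->
  csynth S t V N -> csynth S t (W * V * W^-1) N.
Proof.
move=> tS uW sV; rewrite /csynth !locM -ctl_conj ?locK //.
  exact: synth_conj.
exact: pro_comm.
Qed.

Lemma csynth_commutator S T t P Q N K :
  t \notin S -> t \notin T -> P \is unitarymx -> Q \is unitarymx ->
  csynth S t P N -> csynth T t Q K ->
  csynth (S :|: T) t (P * Q * P^-1 * Q^-1) (N + K + N + K).
Proof.
move=> tS tT uP uQ sP sQ; rewrite /csynth !locM proU.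
rewrite -ctl_commutator ?proK ?locK //; try exact: pro_comm; try exact: proC.
do 3?[apply: synthM => //]; exact: csynthV.
Qed.

(** A scalar is the same operator on every factor, so a controlled phase on [t] can be moved to a
    control [x], where it becomes a phase gate with one control less. *)
Lemma ctl_phase S t x V s : t \notin S -> x \in S ->
  ctl (pro S) (loc t (s *: V)) =
  ctl (pro (S :\ x)) (loc x (phase_mx p s)) * ctl (pro S) (loc t V).
Proof.
move=> tS xS; rewrite -mul_scalar_mx mulmxE locM ctlM ?proK //; last exact: pro_comm.
congr (_ * _); rewrite /phase_mx loc_ctl -pro1 ctl_ctl -proU.
by rewrite setUC setD1K // (loc_scalar M t x).
Qed.

Lemma csynth_phase S t x V s N K : t \notin S -> x \in S ->
  csynth (S :\ x) x (phase_mx p s) N -> csynth S t V K ->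
  csynth S t (s *: V) (N + K).
Proof. by move=> tS xS sN sK; rewrite /csynth (ctl_phase _ _ tS xS); apply: synthM. Qed.

Lemma csynth0 t V : V \is unitarymx -> csynth set0 t V 0.
Proof. by move=> uV; rewrite /csynth pro0 /ctl mul1r addrC subrK; apply: synth_loc. Qed.

Lemma csynth1_shift_like i t P : i != t -> shift_like P ->
  csynth [set i] t P 1.
Proof.
move=> it [A [s [uA s1 ->]]]; have ti : t \notin [set i] by rewrite inE eq_sym.
rewrite -[1]add0r; apply: (@csynth_phase _ _ i); rewrite ?set11 //.
  rewrite setDv; exact/csynth0/phase_mx_unitary.
by apply: csynth_conj => //; apply: synth_cinc.
Qed.

(** Up to a phase, [U] is the product of a shift-like P and of Q P^-1 Q^-1. The latter is a
    conjugate of P^-1, so each of the two costs one CINC. *)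
Lemma csynth1_unitary i t U : i != t -> U \is unitarymx ->
  csynth [set i] t U 2.
Proof.
move=> it uU; have ti : t \notin [set i] by rewrite inE eq_sym.
have [s s1 ds] := scaled_to_SU uU.
have [P [Q [lP lQ _ _ EU]]] := SU_commutator (unitaryZ s1 uU) ds.
have s0 : s != 0 by rewrite -normr_gt0 s1.
have -> : U = s^-1 *: (P * (Q * P^-1 * Q^-1)).
  by rewrite !mulrA -EU scalerA mulVf // scale1r.
have [uP uQ] := (shift_like_unitary lP, shift_like_unitary lQ).
rewrite -[2]add0r; apply: (@csynth_phase _ _ i); rewrite ?set11 //.
  by rewrite setDv; apply/csynth0/phase_mx_unitary; rewrite normfV s1 invr1.
apply: csynthM => //; first exact: csynth1_shift_like.
apply: csynth_conj => //; apply: csynthV => //.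
exact: csynth1_shift_like.
Qed.

Lemma set_half S : exists S1 S2, [/\ S = S1 :|: S2, [disjoint S1 & S2],
  #|S1| = #|S|./2 & #|S2| = uphalf #|S|].
Proof.
have [|S1 S1S cS1] := @exists_subset_card _ S #|S|./2.
  by rewrite -{2}[#|S|]odd_double_half -addnn; lia.
exists S1, (S :\: S1); split => //.
- by rewrite setDE setUIr setUCr setIT; apply/esym/setUidPr.
- by rewrite -setI_eq0 setIDA setDIl setDv set0I.
have := cardsD S S1; rewrite (setIidPr S1S) cS1 => ->.
by rewrite uphalf_half -{1}[#|S|]odd_double_half -addnn; lia.
Qed.

(** With one control the count is 1, which a shift-like gate attains; the factors given by
    [SU_commutator] are always shift-like, so the recursion may end there. *)
Lemma csynth_rec S t U : t \notin S -> (0 < #|S|)%N ->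
  U \is unitarymx -> \det U = 1 -> (#|S| = 1%N -> shift_like U) ->
  csynth S t U (N_SU_rec #|S|.+1).
Proof.
have [m] := ubnP #|S|; elim: m S U => // m IH S U Sm tS S0 uU dU US.
have [S1|S1] := eqVneq #|S| 1%N.
  have /cards1P[i Si] := introT eqP S1; rewrite Si cards1.
  apply: csynth1_shift_like; last exact: US.
  by apply: contraNneq tS => <-; rewrite Si set11.
have S2 : (2 <= #|S|)%N by lia.
have [P [Q [lP lQ dP dQ ->]]] := SU_commutator uU dU.
have [A [B [ES _ cA cB]]] := set_half S.
rewrite N_SU_rec_half // -cA -cB {1}ES.
have [uP uQ] := (shift_like_unitary lP, shift_like_unitary lQ).
have /norP[tA tB] : ~~ ((t \in A) || (t \in B)) by rewrite -in_setU -ES.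
apply: csynth_commutator => //; apply: IH => //; lia.
Qed.

End Synthesis.

(** * The ladder on borrowed qudits *)

Lemma conj_mul_comm (R : pzRingType) (u v w k : R) : GRing.comm k w ->
  u * (v * k) * w = u * v * w * k.
Proof. by move=> kw; rewrite -!mulrA kw. Qed.

(** Here [m] and [m'] invert [u * k] and [v * l]. Moving [k] next to [m] and [l] next to [m'] leaves
    [u'] and [v'], so [k] and [l] disappear. *)
Lemma commutator_absorb (R : pzRingType) (u u' v v' k l m m' : R) :
  u' * u = 1 -> v' * v = 1 -> u * k * m = 1 -> v * l * m' = 1 ->
  GRing.comm k v -> GRing.comm k l -> GRing.comm l u' ->
  u * k * (v * l) * m * m' = u * v * u' * v'.
Proof.
move=> uu vv Em Em' kv kl lu.
have <- : l * m' = v' by rewrite -[v']mulr1 -Em' !mulrA vv mul1r.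
have km : k * m = u' by rewrite -[u']mulr1 -Em !mulrA uu mul1r.
rewrite [RHS]mulrA -[in RHS](mulrA (u * v)) -lu -km.
by rewrite -!mulrA (mulrA k v) kv -!mulrA (mulrA k l) kl -!mulrA.
Qed.

Lemma half_uphalf m : (m./2 + uphalf m = m)%N.
Proof. by rewrite uphalf_half -{4}[m]odd_double_half -addnn addnCA. Qed.

Lemma half_bounds m : (6 <= m)%N -> [/\ 3 <= m./2, 3 <= uphalf m,
  m./2 <= (uphalf m).+2 & uphalf m <= m./2.+2]%N.
Proof.
by move=> m6; have := odd_double_half m; rewrite uphalf_half; split; lia.
Qed.

Section Ladder.
Variables (C : numClosedFieldType) (n p : nat) (M : circuit_model C n p).
Local Notation d := p.+2.
Local Notation X := (cyclic_mx C p).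
Local Notation loc := (loc M).
Local Notation pro := (pro M).
Local Notation synth := (@synth _ _ _ M).
Local Notation csynth := (csynth M).
Implicit Types (S T A F : {set 'I_n}) (t x a b : 'I_n) (K : M).

(** * Couplings between two qudits *)

Section Coupling.
Variable Z : 'M[C]_d.

Definition coupling a b : M :=
  select (fun i => loc a (level_mx C i)) (fun i : 'I_d => loc b (Z ^+ i)).

Lemma loc_levelM a (i j : 'I_d) : loc a (level_mx C i) * loc a (level_mx C j) =
  if i == j then loc a (level_mx C i) else 0.
Proof. by rewrite -locM level_mxM; case: ifP => // _; rewrite loc0. Qed.

Lemma loc_level_sum a : \sum_(i < d) loc a (level_mx C i) = 1.
Proof.
rewrite -(loc1 M a) -sum_level_mx.
exact/esym/(big_morph _ (locD M a) (loc0 M a)).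
Qed.

(** X on [a] raises the exponent of Z on [b] by one; at the wrap-around from d - 1 to 0 the
    exponents differ by d, and Z^d = 1. *)
Lemma coupling_shift a b : a != b -> Z ^+ d = 1 ->
  coupling a b * loc a X = loc a X * loc b Z * coupling a b.
Proof.
move=> ab Zd; rewrite /coupling /select mulr_suml mulr_sumr.
rewrite (reindex_inj (@ordS_inj d)); apply: eq_bigr => i _.
have -> : Z ^+ (ordS i) = Z * Z ^+ i.
  rewrite -exprS val_ordS; case: eqP => // ->; by rewrite Zd.
rewrite -mulrA (loc_comm M (Z * _) X (_ : b != a)); last by rewrite eq_sym.
rewrite mulrA -locM -cyclic_level locM -!mulrA; congr (_ * _).
by rewrite locM !mulrA; congr (_ * _); apply: loc_comm.
Qed.

Lemma comm_coupling a b K : 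
  (forall W, GRing.comm K (loc a W)) -> (forall W, GRing.comm K (loc b W)) ->
  GRing.comm K (coupling a b).
Proof. by move=> Ka Kb; apply: comm_select => i. Qed.

Lemma coupling_diag a b (w : 'rV_d) : a != b ->
  GRing.comm (loc a (diag_mx w)) (coupling a b).
Proof.
move=> ab; apply: comm_select => i; last exact: loc_comm.
by apply: locC; apply: diag_mx_comm.
Qed.

Lemma synth_ctl_level a b (i : 'I_d) W N : a != b ->
  csynth [set a] b W N -> synth (ctl (loc a (level_mx C i)) (loc b W)) N.
Proof.
move=> ab sW; have [T uT ->] := level_mx_conj C i.
have -> : ctl (loc a (T * level_mx C ord_max * T^-1)) (loc b W) =
    loc a T * ctl (pro [set a]) (loc b W) * loc a T^-1.
  rewrite /ctl pro1 [in RHS]mulrDr mulr1 [in RHS]mulrDl locK //; congr (1 + _).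
  rewrite !locM -!mulrA; do 2 congr (_ * _).
  by rewrite mulrBl mulrBr mulr1 mul1r (loc_comm M _ _ ab).
exact: synth_conj.
Qed.

Lemma synth_coupling a b (h : 'I_d -> int) : a != b ->
  (forall i : 'I_d, csynth [set a] b (Z ^+ i) (h i)) ->
  synth (coupling a b) (\sum_i h i).
Proof.
move=> ab sZ; rewrite /coupling -prod_ctl_select; first last.
- by move=> i j; apply: loc_comm.
- exact: loc_level_sum.
- exact: loc_levelM.
apply: (big_ind2 (fun g N => synth g N)); first exact: synth1.
  by move=> g N g' N'; apply: synthM.
by move=> i _; apply: synth_ctl_level.
Qed.

End Coupling.

Lemma couplingK a b Z : a != b -> Z \is unitarymx ->
  coupling Z a b * coupling Z^-1 a b = 1.
Proof.
move=> ab uZ; rewrite selectM; last 2 first.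
- exact: loc_levelM.
- by move=> i j; apply: loc_comm.
rewrite -(select1 (loc_level_sum a)); apply: eq_bigr => i _; congr (_ * _).
rewrite -locM -exprMn_comm; last first.
  by rewrite /GRing.comm (unitary_mulmxV uZ) (unitary_mulVmx uZ).
by rewrite (unitary_mulmxV uZ) expr1n loc1.
Qed.

(** * Staircases on borrowed qudits *)

Section Staircase.
Variables (Y : 'M[C]_d) (v : 'rV[C]_d) (s : C) (cY cH : int).
Local Notation Z := (diag_mx v).
Local Notation V := (s *: Z).
Local Notation H := (coupling Z).
Local Notation H' := (coupling Z^-1).
Hypotheses (uY : Y \is unitarymx) (uZ : Z \is unitarymx) (s1 : `|s| = 1)
  (EX : Y * Z * Y^-1 = X) (dV : \det V = 1).
(** Both costs stay abstract, since their values depend on whether d is 2, 3 or larger. *)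
Hypothesis costY : forall x a, x != a -> csynth [set x] a Y cY.
Hypothesis costH : forall a b, a != b -> synth (H a b) cH.

Let uV : V \is unitarymx. Proof. exact: unitaryZ. Qed.

Let Zd : Z ^+ d = 1. Proof. exact: (conj_cyclic_order uY EX). Qed.

Definition rung x a b : M := H a b * ctl (pro [set x]) (loc a Y).
Definition rung_inv x a b : M := ctl (pro [set x]) (loc a Y^-1) * H' a b.

Lemma rungK x a b : x != a -> a != b -> rung x a b * rung_inv x a b = 1.
Proof.
move=> xa ab; rewrite /rung /rung_inv mulrA -[_ * _ * ctl _ _]mulrA -ctlM ?proK //.
  by rewrite locK // ctl1 mulr1 couplingK.
by apply: pro_comm; rewrite inE eq_sym.
Qed.

Lemma synth_rung x a b : x != a -> a != b -> synth (rung x a b) (cH + cY).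
Proof. by move=> xa ab; apply: synthM; [apply: costH | apply: costY]. Qed.

Lemma synth_rung_inv x a b : x != a -> a != b ->
  synth (rung_inv x a b) (cH + cY).
Proof. by move=> xa ab; apply: (synthV (synth_rung xa ab)); apply: rungK. Qed.

Lemma coupling_inv_diag a b (w : 'rV_d) : a != b ->
  H a b * loc a (diag_mx w) * H' a b = loc a (diag_mx w).
Proof.
by move=> ab; rewrite -(coupling_diag _ _ ab) -mulrA couplingK // mulr1.
Qed.

Lemma rung_conj x a b : x != a -> x != b -> a != b ->
  rung x a b * loc a V * rung_inv x a b =
  ctl (pro [set x]) (loc b V * loc a (X * V^-1)) * loc a V.
Proof.
move=> xa xb ab; rewrite /rung /rung_inv.
have ax : a \notin [set x] by rewrite inE eq_sym.
have bx : b \notin [set x] by rewrite inE eq_sym.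
have EV : V = diag_mx (s *: v) by rewrite linearZ.
have dV' : V^-1 = diag_mx (\row_i ((s *: v) 0 i)^-1).
  by rewrite EV diag_inv // -EV.
set q := pro [set x]; set c := ctl q _; set c' := ctl q (loc a Y^-1).
have Hq : GRing.comm q (H a b).
  by apply: comm_coupling => W; apply: pro_comm.
have -> : H a b * c * loc a V * (c' * H' a b) =
    H a b * (c * loc a V * c') * H' a b by rewrite !mulrA.
(* Under the control Y V Y^-1 = s X, so conjugating V puts a controlled s X V^-1 in front of it. *)
have -> : c * loc a V * c' = ctl q (loc a (s *: X * V^-1)) * loc a V.
  have -> : c' = loc a V^-1 * ctl q (loc a (V * Y^-1 * V^-1)) * loc a V.
    rewrite !locM -ctl_conj ?locK //; last exact: pro_comm.
    by rewrite !mulrA locVK // mul1r -!mulrA locVK // mulr1.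
  rewrite !mulrA -[c * _ * _]mulrA locK // mulr1 -ctlM ?proK //.
    rewrite -locM !mulrA; congr (ctl _ (loc _ (_ * _)) * _).
    by rewrite scale_mulmxr scale_mulmxl EX.
  exact: pro_comm.
have -> : H a b * (ctl q (loc a (s *: X * V^-1)) * loc a V) * H' a b =
    H a b * ctl q (loc a (s *: X * V^-1)) * H' a b * loc a V.
  by rewrite EV -!mulrA (coupling_diag Z^-1 _ ab).
rewrite ctl_conj ?couplingK //; congr (ctl _ _ * _).
(* D is diagonal, so it passes through the coupling, while X on [a] picks up Z on [b]. The scalar s
   inside D is then moved to [b], where s Z = V. *)
pose D := s *: V^-1.
have ED : D = diag_mx (s *: \row_i ((s *: v) 0 i)^-1) by rewrite /D dV' linearZ.
have -> : s *: X * V^-1 = X * D by rewrite scale_mulmxl scale_mulmxr.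
rewrite locM mulrA coupling_shift // -!mulrA ED.
rewrite [H a b * _]mulrA coupling_inv_diag // -ED.
have -> : loc a D = loc b s%:M * loc a V^-1.
  by rewrite -(loc_scalar M a b) -locM -mulmxE mul_scalar_mx.
rewrite [loc b Z * _]mulrA -locM.
have -> : Z * s%:M = V by rewrite -mulmxE mul_mx_scalar.
by rewrite mulrA (loc_comm M X V ab) -mulrA -locM.
Qed.

(** Acting on the factors in [F] only is expressed by commutation with all local gates elsewhere,
    the form in which locality is used below. *)
Definition supported F K :=
  forall j W, j \notin F -> GRing.comm K (loc j W).

Lemma supported_loc F a W : a \in F -> supported F (loc a W).
Proof. by move=> aF j U jF; apply: loc_comm; apply: contraNneq jF => <-. Qed.

Lemma supported_pro F S : S \subset F -> supported F (pro S).
Proof.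
move=> SF j W jF; apply: pro_comm; apply: contraNN jF; exact: (subsetP SF).
Qed.

Lemma supported_ctl F S K : S \subset F -> supported F K ->
  supported F (ctl (pro S) K).
Proof.
move=> SF sK j W jF; apply/commr_sym/comm_ctl; apply/commr_sym.
  exact: (supported_pro SF).
exact: sK.
Qed.

Lemma supportedM F K L : supported F K -> supported F L -> supported F (K * L).
Proof.
by move=> sK sL j W jF; apply/commr_sym/commrM; apply/commr_sym; [apply: sK | apply: sL].
Qed.

Lemma supportedS F A K : F \subset A -> supported F K -> supported A K.
Proof.
move=> FA sK j W jA; apply: sK; apply: contraNN jA; exact: (subsetP FA).
Qed.

Lemma supported_pro_comm F S K : supported F K -> [disjoint S & F] ->
  GRing.comm K (pro S).
Proof.
by move=> sK SF; apply: comm_pro => i iS; apply: sK; rewrite (disjointFr SF).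
Qed.

Lemma supported_rung F K x a b : supported F K ->
  x \notin F -> a \notin F -> b \notin F ->
  GRing.comm K (rung x a b) /\ GRing.comm K (rung_inv x a b).
Proof.
move=> sK xF aF bF.
have cc Z' : GRing.comm K (coupling Z' a b).
  by apply: comm_coupling => W; apply: sK.
have cY' W : GRing.comm K (ctl (pro [set x]) (loc a W)).
  apply: comm_ctl; last exact: sK.
  by apply: (supported_pro_comm sK); rewrite disjoints1.
by split; apply: commrM.
Qed.

Lemma pro_comm_rung S x a b : a \notin S -> b \notin S ->
  GRing.comm (pro S) (rung x a b).
Proof.
move=> aS bS; apply: commrM.
  by apply: comm_coupling => W; apply: pro_comm.
by apply: comm_ctl; [apply: proC | apply: pro_comm].
Qed.

(** The rung commutes with [pro S], so [rung_conj] applies under the controls in [S]. On the right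
    only the first factor is the wanted gate on [b]; the last factor is the operator that was
    conjugated, ready to be cancelled. *)
Lemma rung_step S x a b K : x \notin S -> a \notin S -> b \notin S ->
  x != a -> x != b -> a != b ->
  GRing.comm K (rung_inv x a b) ->
  rung x a b * (ctl (pro S) (loc a V) * K) * rung_inv x a b =
  ctl (pro (x |: S)) (loc b V) *
    ctl (pro (x |: S)) (loc a (X * V^-1)) * (ctl (pro S) (loc a V) * K).
Proof.
move=> xS aS bS xa xb ab cK.
have -> : rung x a b * (ctl (pro S) (loc a V) * K) * rung_inv x a b =
    rung x a b * ctl (pro S) (loc a V) * rung_inv x a b * K.
  exact: conj_mul_comm.
rewrite ctl_conj ?rungK ?rung_conj //; last exact: pro_comm_rung.
rewrite [in RHS]mulrA; congr (_ * _).
have [xa' xb'] : a \notin [set x] /\ b \notin [set x].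
  by rewrite !inE ![_ == x]eq_sym.
have aS' : GRing.comm (pro S) (loc a (X * V^-1)) by apply: pro_comm.
have bS' : GRing.comm (pro S) (loc b V) by apply: pro_comm.
rewrite ctlM ?proK //; last first.
  by apply: comm_ctl; [apply: proC | apply: commrM].
rewrite ctl_ctl -proU setUC; congr (_ * _); apply: ctlM; first exact: proK.
by apply: pro_comm; rewrite !inE negb_or [b == x]eq_sym xb.
Qed.

Let g : int := cH + cY.

(** Each induction step conjugates by one rung, at cost 2 g, using up one control and one borrowed
    qudit. The base case with two controls costs [N_SU_rec 3], which is 4. *)
Lemma staircase k S A b : #|S| = k.+2 -> #|A| = k -> [disjoint S & A] ->
  b \notin S -> b \notin A ->
  exists2 K, supported (S :|: A) K &
    synth (ctl (pro S) (loc b V) * K) (2 * k%:Z * g + 4).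
Proof.
elim: k S A b => [|k IH] S A b cS cA SA bS bA.
  exists 1; first by move=> j W _; apply/commr_sym/commr1.
  rewrite mulr1 mulr0 mul0r add0r.
  have -> : 4 = N_SU_rec #|S|.+1 by rewrite cS.
  by apply: csynth_rec; rewrite ?cS.
have [x xS] : exists x, x \in S by apply/card_gt0P; rewrite cS.
have [a aA] : exists a, a \in A by apply/card_gt0P; rewrite cA.
have aS : a \notin S by rewrite (disjointFl SA).
have xA : x \notin A by rewrite (disjointFr SA).
have xa : x != a by apply: contraNneq xA => ->.
have xb : x != b by apply: contraNneq bS => <-.
have ab : a != b by apply: contraNneq bA => <-.
have aSx : a \notin S :\ x by rewrite !inE negb_and aS orbT.
(* The smaller staircase targets the borrowed qudit [a]; the rung then moves the target to [b] and
   adds the control [x]. *)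
have [|||||K sK synK] := IH (S :\ x) (A :\ a) a.
- by move: cS; rewrite (cardsD1 x) xS => -[].
- by move: cA; rewrite (cardsD1 a) aA => -[].
- apply: disjointWl (subsetDl _ _) _; apply: disjointWr (subsetDl _ _) SA.
- done.
- by rewrite setD11.
have NF y : (y == x) || (y == a) || (y == b) -> y \notin (S :\ x) :|: (A :\ a).
  by rewrite !inE => /orP[/orP[]|] /eqP ->;
    rewrite ?eqxx ?(negPf xA) ?(negPf aS) ?(negPf bS) ?(negPf bA) ?andbF.
have [_ cK] : GRing.comm K (rung x a b) /\ GRing.comm K (rung_inv x a b).
  by apply: (supported_rung sK); apply: NF; rewrite eqxx ?orbT.
exists (ctl (pro S) (loc a (X * V^-1)) * (ctl (pro (S :\ x)) (loc a V) * K)).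
  have SDA : S :\ x \subset S :|: A by rewrite (subset_trans (subsetDl _ _)) ?subsetUl.
  apply: supportedM; last apply: supportedM.
  - apply: supported_ctl; first exact: subsetUl.
    by apply: supported_loc; rewrite inE aA orbT.
  - by apply: supported_ctl => //; apply: supported_loc; rewrite inE aA orbT.
  - by apply: supportedS sK; apply: setUSS; apply: subsetDl.
have bSx : b \notin S :\ x by rewrite !inE negb_and bS orbT.
have E := rung_step (negbT (setD11 x S)) aSx bSx xa xb ab cK.
rewrite !(setD1K xS) in E; rewrite mulrA -E.
have -> : 2 * k.+1%:Z * g + 4 = g + (2 * k%:Z * g + 4) + g.
  by rewrite intS; ring.
apply: synthM; last exact: synth_rung_inv.
by apply: synthM => //; apply: synth_rung.
Qed.

(** For a staircase N with target [a] and a rung G towards [t], the commutator of G and N loses the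
    unknown part of N. It uses G and N twice each, up to inversion: 2 g + 2 (2 k g + 4). *)
Lemma half_gate k S A a t B : #|S| = k.+3 -> #|A| = k -> [disjoint S & A] ->
  a \notin S -> a \notin A -> t \notin S -> t \notin A -> t != a ->
  B \is unitarymx ->
  exists w, synth (ctl (pro S) (loc t (B * V * B^-1)) *
                   ctl (pro S) (loc a (diag_mx w)))
                  ((4 * k%:Z + 2) * g + 8).
Proof.
move=> cS cA SA aS aA tS tA ta uB.
have [x xS] : exists x, x \in S by apply/card_gt0P; rewrite cS.
have xA : x \notin A by rewrite (disjointFr SA).
have xa : x != a by apply: contraNneq aS => <-.
have xt : x != t by apply: contraNneq tS => <-.
have at_ : a != t by rewrite eq_sym.
have aSx : a \notin S :\ x by rewrite !inE negb_and aS orbT.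
have tSx : t \notin S :\ x by rewrite !inE negb_and tS orbT.
have [||||K sK synK] := @staircase k (S :\ x) A a _ cA.
- by move: cS; rewrite (cardsD1 x) xS => -[].
- exact: disjointWl (subsetDl _ _) SA.
- done.
- done.
have NF y : (y == x) || (y == a) || (y == t) -> y \notin (S :\ x) :|: A.
  by rewrite !inE => /orP[/orP[]|] /eqP ->;
    rewrite ?eqxx ?(negPf xA) ?(negPf aS) ?(negPf tS) ?(negPf aA) ?(negPf tA) ?andbF.
have [_ cK] : GRing.comm K (rung x a t) /\ GRing.comm K (rung_inv x a t).
  by apply: (supported_rung sK); apply: NF; rewrite eqxx ?orbT.
have [N' NN' synN'] := synth_inv synK.
have uW : X * V^-1 \is unitarymx.
  by rewrite unitaryM ?unitaryV ?cyclic_mx_unitary.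
(* The residual gate on [a] is diagonalised, so that a single-qudit change of basis on [a] turns it
   into [diag_mx w]. *)
have [D [w [uD _ EW]]] := unitary_diagonalize uW.
exists w.
have synG : synth (ctl (pro S) (loc t V) * ctl (pro S) (loc a (X * V^-1)))
    ((4 * k%:Z + 2) * g + 8).
  have := rung_step (negbT (setD11 x S)) aSx tSx xa xt at_ cK; rewrite !(setD1K xS).
  move/(congr1 (fun u => u * N')); rewrite -[RHS]mulrA NN' mulr1 => <-.
  have -> : (4 * k%:Z + 2) * g + 8 =
      g + (2 * k%:Z * g + 4) + g + (2 * k%:Z * g + 4) by ring.
  apply: synthM => //; apply: synthM; last exact: synth_rung_inv.
  by apply: synthM => //; apply: synth_rung.
have -> : ctl (pro S) (loc t (B * V * B^-1)) * ctl (pro S) (loc a (diag_mx w)) =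
    loc t B * (loc a D^-1 * (ctl (pro S) (loc t V) *
       ctl (pro S) (loc a (X * V^-1))) * loc a D) * loc t B^-1.
  have -> : loc a D^-1 * (ctl (pro S) (loc t V) * ctl (pro S) (loc a (X * V^-1)))
      * loc a D = ctl (pro S) (loc t V) * ctl (pro S) (loc a (diag_mx w)).
    have cD : GRing.comm (loc a D^-1) (ctl (pro S) (loc t V)).
      by apply: comm_ctl; [apply/commr_sym/pro_comm | apply: loc_comm].
    rewrite mulrA cD -!mulrA; congr (_ * _); rewrite mulrA ctl_conj ?locVK //.
      rewrite EW -!locM; congr (ctl _ (loc _ _)).
      by rewrite !mulrA (unitary_mulVmx uD) mul1r -mulrA (unitary_mulVmx uD) mulr1.
    exact: pro_comm.
  rewrite conj_mul_comm; last first.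
    apply/commr_sym/comm_ctl; first exact/commr_sym/pro_comm.
    exact: loc_comm.
  by rewrite ctl_conj ?locK ?locM //; apply: pro_comm.
apply: synth_conj => //; rewrite -{2}[D]invrK; apply: synth_conj => //.
exact: unitaryV.
Qed.

Lemma half_gate_split S T t B : [disjoint S & T] -> t \notin S -> t \notin T ->
  (3 <= #|S|)%N -> (#|S| <= #|T|.+2)%N -> B \is unitarymx ->
  exists a w, a != t /\
    synth (ctl (pro S) (loc t (B * V * B^-1)) * ctl (pro S) (loc a (diag_mx w)))
          ((4 * #|S|%:Z - 10) * g + 8).
Proof.
move=> ST tS tT S3 SleT uB.
have T0 : (0 < #|T|)%N by lia.
have [a aT] : exists a, a \in T by apply/card_gt0P.
have ta : t != a by apply: contraNneq tT => ->.
(* [half_gate] is used with k = |S| - 3: besides [a] it borrows k further qudits, all taken from the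
   other half [T]. *)
have cTa : (#|S| - 3 <= #|T :\ a|)%N.
  by have := cardsD1 a T; rewrite aT add1n => cT; move: SleT; rewrite cT leq_subLR.
have [A AT cA] := exists_subset_card cTa.
have AT' : A \subset T by apply: subset_trans AT (subsetDl _ _).
have cS : #|S| = (#|S| - 3).+3%N by lia.
have [|||||||w synw] := @half_gate _ S A a t B cS cA.
- exact: disjointWr AT' ST.
- by rewrite (disjointFl ST).
- by apply/negP => /(subsetP AT); rewrite setD11.
- done.
- by apply: contraNN tT; apply: (subsetP AT').
- done.
- done.
exists a, w; rewrite eq_sym; split => //.
have -> : 4 * #|S|%:Z - 10 = 4 * (#|S| - 3)%N%:Z + 2 by lia.
exact: synw.
Qed.

(* The diagonal factors commute with everything present and cancel in the
   commutator, although a1 and a2 may be controls of the other gate. *)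
Lemma csynth_commutator_diag S T t P Q a1 w1 a2 w2 N N' :
  t \notin S -> t \notin T -> P \is unitarymx -> Q \is unitarymx ->
  a1 != t -> a2 != t ->
  synth (ctl (pro S) (loc t P) * ctl (pro S) (loc a1 (diag_mx w1))) N ->
  synth (ctl (pro T) (loc t Q) * ctl (pro T) (loc a2 (diag_mx w2))) N' ->
  csynth (S :|: T) t (P * Q * P^-1 * Q^-1) (N + N' + N + N').
Proof.
move=> tS tT uP uQ at1 at2 syn1 syn2.
have [m1 E1 synm1] := synth_inv syn1; have [m2 E2 synm2] := synth_inv syn2.
have ct F F' a w W : a != t -> t \notin F ->
    GRing.comm (ctl (pro F) (loc a (diag_mx w))) (ctl (pro F') (loc t W)).
  move=> at_ tF; apply: comm_ctl.
    by apply/commr_sym/comm_ctl; [apply: proC | apply: pro_comm_diag].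
  by apply/commr_sym/comm_ctl;
    [apply/commr_sym/pro_comm | apply: loc_comm; rewrite eq_sym].
rewrite /csynth !locM proU.
rewrite -ctl_commutator ?proK ?locK //; try exact: pro_comm; try exact: proC.
have ctK F W : t \notin F -> W \is unitarymx ->
    ctl (pro F) (loc t W^-1) * ctl (pro F) (loc t W) = 1.
  by move=> tF uW; rewrite -ctlM ?proK ?locVK ?ctl1 //; apply: pro_comm.
rewrite -(@commutator_absorb M _ _ _ _ _ _ _ _ (ctK _ _ tS uP)
  (ctK _ _ tT uQ) E1 E2).
- by do 3?[apply: synthM => //].
- exact: ct.
- apply: comm_ctl; last apply/commr_sym/comm_ctl.
  + by apply/commr_sym/comm_ctl; [apply: proC | apply: pro_comm_diag].
  + exact/commr_sym/pro_comm_diag.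
  + case: (eqVneq a2 a1) => [->|a21]; last exact: loc_comm.
    by apply: locC; apply: diag_mx_comm.
- exact: ct.
Qed.

(** Since X = Y Z Y^-1 and V = s Z, a shift-like gate is a conjugate of V up to a phase, and phases
    cancel in the commutator. *)
Lemma SU_commutator_V U : U \is unitarymx -> \det U = 1 ->
  exists B D, [/\ B \is unitarymx, D \is unitarymx &
    U = (B * V * B^-1) * (D * V * D^-1) * (B * V * B^-1)^-1 * (D * V * D^-1)^-1].
Proof.
move=> uU dU; have [P [Q [lP lQ _ _ ->]]] := SU_commutator uU dU.
have sV P' : shift_like P' -> exists B c, [/\ B \is unitarymx, `|c| = 1 &
    P' = c *: (B * V * B^-1)].
  case=> B [c [uB c1 ->]]; exists (B * Y), (c / s); split.
  - exact: unitaryM.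
  - by rewrite normrM normfV s1 c1 invr1 mulr1.
  have s0 : s != 0 by rewrite -normr_gt0 s1.
  rewrite scale_mulmxr scale_mulmxl scalerA divfK // invrM ?unitary_unit //.
  by rewrite -EX !mulrA.
have [B [b [uB b1 ->]]] := sV _ lP; have [D [c [uD c1 ->]]] := sV _ lQ.
by exists B, D; rewrite commutatorZ // !unitaryM ?unitaryV.
Qed.

(** With six controls each half has at least three, as [half_gate_split] requires. Each half gate
    and its inverse occur once, which doubles the sum of the two costs. *)
Lemma csynth_linear S t U : t \notin S -> (6 <= #|S|)%N ->
  U \is unitarymx -> \det U = 1 ->
  csynth S t U ((8 * #|S|%:Z - 40) * g + 32).
Proof.
move=> tS S6 uU dU; have [B [D [uB uD ->]]] := SU_commutator_V uU dU.
have uP : B * V * B^-1 \is unitarymx by rewrite !unitaryM ?unitaryV.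
have uQ : D * V * D^-1 \is unitarymx by rewrite !unitaryM ?unitaryV.
have [S1 [S2 [ES dS cS1 cS2]]] := set_half S.
have cS : #|S| = (#|S1| + #|S2|)%N by rewrite cS1 cS2 half_uphalf.
have /norP[tS1 tS2] : ~~ ((t \in S1) || (t \in S2)) by rewrite -in_setU -ES.
have [le1 le2 le3 le4] := half_bounds S6.
have [|||a1 [w1 [at1 syn1]]] := @half_gate_split S1 S2 t B dS tS1 tS2.
- by rewrite cS1.
- by rewrite cS1 cS2.
- exact: uB.
have [||||a2 [w2 [at2 syn2]]] := @half_gate_split S2 S1 t D _ tS2 tS1.
- by rewrite disjoint_sym.
- by rewrite cS2.
- by rewrite cS1 cS2.
- exact: uD.
have -> : (8 * #|S|%:Z - 40) * g + 32 =
    ((4 * #|S1|%:Z - 10) * g + 8) + ((4 * #|S2|%:Z - 10) * g + 8) +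
    ((4 * #|S1|%:Z - 10) * g + 8) + ((4 * #|S2|%:Z - 10) * g + 8).
  by rewrite cS PoszD; ring.
by rewrite ES; apply: (csynth_commutator_diag _ _ _ _ at1 at2 syn1 syn2).
Qed.

End Staircase.
End Ladder.

(** * The gate counts *)

(* For d = 2 the diagonalising matrix Y must itself be conjugate to X up to a
   phase, so that its controlled version costs one CINC instead of two. *)
Section Hadamard.
Variable C : numClosedFieldType.
Local Notation X := (cyclic_mx C 0).

Lemma traceless_diagonalize (U : 'M[C]_2) : U \is unitarymx -> \tr U = 0 ->
  exists A c, [/\ A \is unitarymx, `|c| = 1 &
    U = c *: (A * diag_mx (\row_(j < 2) (-1) ^+ j) * A^-1)].
Proof.
move=> uU trU; have [A [v [uA uv EU]]] := unitary_diagonalize uU.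
exists A, (v 0 0); split=> //.
  by move: uv; rewrite unitary_diag => /forallP/(_ 0)/eqP.
have v1 : v 0 1 = - v 0 0.
  apply/eqP; rewrite -addr_eq0 addrC; apply/eqP; rewrite -trU EU.
  rewrite -!mulmxE mxtrace_mulC mulmxA mulmxE (unitary_mulVmx uA) mul1r.
  by rewrite mxtrace_diag big_ord_recl big_ord1; congr (_ + v 0 _); apply: val_inj.
rewrite EU -scale_mulmxl -scale_mulmxr; congr (_ * _ * _).
rewrite -linearZ /=; congr diag_mx; apply/rowP => j; rewrite !mxE.
case: j => [[|[|//]] ij]; rewrite ?expr0 ?expr1 ?mulr1 ?mulrN1 -?v1;
  by congr (v 0 _); apply: val_inj.
Qed.

(** A traceless 2 by 2 unitary has eigenvalues c and -c, and so has X for another phase; hence the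
    two are conjugate up to a phase. *)
Lemma traceless_shift_like (U : 'M[C]_2) : U \is unitarymx -> \tr U = 0 ->
  shift_like U.
Proof.
move=> uU trU; have [A [c [uA c1 EU]]] := traceless_diagonalize uU trU.
have trX : \tr X = 0.
  by rewrite /mxtrace big_ord_recl big_ord1 !mxE /= addr0.
have [B [b [uB b1 EX]]] := traceless_diagonalize (cyclic_mx_unitary C 0) trX.
have b0 : b != 0 by rewrite -normr_gt0 b1.
exists (A * B^-1), (c / b); split.
- by rewrite unitaryM ?unitaryV.
- by rewrite normrM normfV b1 c1 invr1 mulr1.
rewrite EU EX scale_mulmxr scale_mulmxl scalerA divfK //; congr (_ *: _).
rewrite invrM ?unitary_unit ?unitaryV // invrK !mulrA.
by rewrite !(mulrVK, mulrK) ?unitary_unit.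
Qed.

Definition hadamard_mx : 'M[C]_2 :=
  (sqrtC 2)^-1 *: \matrix_(i, j) (-1) ^+ (i * j).

Lemma hadamard_spec : [/\ hadamard_mx \is unitarymx, shift_like hadamard_mx &
  hadamard_mx * diag_mx (\row_(j < 2) (-1) ^+ j) = X * hadamard_mx].
Proof.
have h2 : 2^-1 * (1 + 1) = 1 :> C by rewrite -mulr2n mulVf ?pnatr_eq0.
have uY : hadamard_mx \is unitarymx.
  apply/unitarymxP; rewrite /hadamard_mx linearZ /= map_mxZ -scalemxAl -scalemxAr.
  rewrite scalerA -normCK normfV ger0_norm ?sqrtC_ge0 // exprVn sqrtCK.
  apply/matrixP => i j; rewrite !mxE big_ord_recl big_ord1 !mxE.
  case: i => [[|[|//]] ?]; case: j => [[|[|//]] ?];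
    rewrite /= ?mul0n ?muln0 ?expr0 ?expr1 ?rmorphN1 ?rmorph1 ?mulr1 ?mulrNN
    ?mul1r ?mulr1 ?subrr ?addNr ?mulr0 //; exact: h2.
split=> //.
  apply: traceless_shift_like => //.
  rewrite /hadamard_mx mxtraceZ /mxtrace big_ord_recl big_ord1 !mxE /=.
  by rewrite expr0 expr1 subrr mulr0.
rewrite /hadamard_mx scale_mulmxl scale_mulmxr; congr (_ *: _).
rewrite -!mulmxE mul_mx_diag; apply/matrixP => i j; rewrite !mxE.
rewrite big_ord_recl big_ord1 !mxE.
case: i => [[|[|//]] ?]; case: j => [[|[|//]] ?]; 
  rewrite /= ?expr0 ?expr1 ?mul0r ?mul1r ?add0r ?addr0 ?mulr1 ?mulrNN ?mulr1 //.
Qed.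

End Hadamard.

(** * Costs of the ladder and induction on the number of controls *)

Section Bounds.
Variables (C : numClosedFieldType) (p : nat).
Local Notation d := p.+2.
Local Notation X := (cyclic_mx C p).

Lemma ladder_frame : exists (Y : 'M[C]_d) v s,
  [/\ Y \is unitarymx, diag_mx v \is unitarymx, `|s| = 1,
     Y * diag_mx v * Y^-1 = X & \det (s *: diag_mx v) = 1] /\
  (p = 0%N -> shift_like Y).
Proof.
suff [Y [v [uY EX lY]]] : exists (Y : 'M[C]_d) v,
    [/\ Y \is unitarymx, Y * diag_mx v * Y^-1 = X & p = 0%N -> shift_like Y].
  have uv : diag_mx v \is unitarymx.
    have -> : diag_mx v = Y^-1 * X * Y.
      by rewrite -EX !mulrA (unitary_mulVmx uY) mul1r -mulrA (unitary_mulVmx uY) mulr1.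
    by rewrite !unitaryM ?unitaryV ?cyclic_mx_unitary.
  by have [s s1 ds] := scaled_to_SU uv; exists Y, v, s.
case: (posnP p) => [->|p0].
  have [uY lY EY] := hadamard_spec C.
  exists (hadamard_mx C), (\row_(j < 2) (-1) ^+ j); split => //.
  by rewrite EY -mulrA (unitary_mulmxV uY) mulr1.
have [Y [v [uY _ EX]]] := unitary_diagonalize (cyclic_mx_unitary C p).
by exists Y, v; split => // p0'; rewrite p0' in p0.
Qed.

Variables (n : nat) (M : circuit_model C n p).
Local Notation csynth := (csynth M).
Implicit Types (S : {set 'I_n}) (t x a b : 'I_n).

Lemma csynth_SU_linear S t U : t \notin S -> (6 <= #|S|)%N ->
  U \is unitarymx -> \det U = 1 -> csynth S t U (N_SU d #|S|.+1).
Proof.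
move=> tS S6 uU dU.
have [Y [v [s [[uY uZ s1 EX dV] lY]]]] := ladder_frame.
pose cY : int := if p == 0%N then 1 else 2.
(* Z is a conjugate of X, so Z and Z^(d-1) = Z^-1 cost one CINC under one control, Z^0 none, and any
   other power at most two. *)
pose h (i : 'I_d) : int := if i == 0%N :> nat then 0
  else if (i == 1%N :> nat) || (i == p.+1 :> nat) then 1 else 2.
have sY x a : x != a -> csynth [set x] a Y cY.
  rewrite /cY => xa; case: (p =P 0%N) => [p0|_]; last exact: csynth1_unitary.
  by apply: csynth1_shift_like => //; apply: lY.
have sZ a b : a != b -> synth (coupling M (diag_mx v) a b) (\sum_i h i).
  move=> ab; apply: synth_coupling => // i; rewrite /h.
  have ba : b \notin [set a] by rewrite inE eq_sym.
  have lZ : shift_like (diag_mx v).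
    exists Y^-1, 1; rewrite normr1 scale1r unitaryV // invrK; split => //.
    by rewrite -EX !mulrA (unitary_mulVmx uY) mul1r -mulrA (unitary_mulVmx uY) mulr1.
  case: (nat_of_ord i =P 0%N) => [->|_].
    by rewrite expr0 /csynth loc1 ctl1; apply: synth1.
  case: (nat_of_ord i =P 1%N) => [->|_] /=; first exact: csynth1_shift_like.
  case: (nat_of_ord i =P p.+1) => [->|_].
    have -> : diag_mx v ^+ p.+1 = (diag_mx v)^-1.
      apply: (mulrI (unitary_unit uZ)); rewrite -exprS.
      by rewrite (conj_cyclic_order uY EX) (unitary_mulmxV uZ).
    by apply: csynthV => //; apply: csynth1_shift_like.
  apply: csynth1_unitary => //.
  elim: (nat_of_ord i) => [|k IH]; first by rewrite expr0 unitary1.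
  by rewrite exprS unitaryM.
apply: csynth_le (csynth_linear uY uZ s1 EX dV sY sZ tS S6 uU dU) _.
have c0 : #|S|%:Z - 5 >= 0 by lia.
rewrite /cY /h /N_SU intS; move: #|S|%:Z c0 => c c0.
case: (p =P 0%N) => [->|p0].
  by rewrite big_ord_recl big_ord1 /=; lia.
case: (p =P 1%N) => [->|p1].
  by rewrite !big_ord_recl big_ord0 /=; lia.
have hb : \sum_(i < d) h i <= 2 * p.+1%:Z.
  rewrite big_ord_recl {1}/h /= add0r.
  apply: (@le_trans _ _ (\sum_(i < p.+1) 2)); last by rewrite sumr_const card_ord; lia.
  by apply: ler_sum => i _; rewrite /h; case: ifP => // _; case: ifP.
have -> : (d == 2%N) = false by lia.
have -> : (d == 3%N) = false by lia.
set hs := \sum_(i < d) _ in hb *.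
(* For d >= 4 each nonzero level is counted as 2, which bounds the rung by 2 d. The stated count
   exceeds the result by (16 d - 40)(c - 5), nonnegative as c >= 6. *)
apply: (@le_trans _ _ ((8 * c - 40) * (2 * p.+1%:Z + 2) + 32)).
  by rewrite lerD2r; apply: ler_wpM2l; [lia | rewrite lerD2r].
have -> : p.+1%:Z = d%:Z - 1 by lia.
rewrite -subr_ge0.
have -> : (32 * d%:Z - 40) * (1 + c) - 192 * d%:Z + 272 -
    ((8 * c - 40) * (2 * (d%:Z - 1) + 2) + 32) = (16 * d%:Z - 40) * (c - 5).
  ring.
by apply: mulr_ge0 => //; lia.
Qed.

Lemma csynth_SU S t U : t \notin S -> (2 <= #|S|)%N ->
  U \is unitarymx -> \det U = 1 ->
  csynth S t U (if (#|S|.+1 <= 6)%N then N_SU_rec #|S|.+1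
                else Num.min (N_SU_rec #|S|.+1) (N_SU d #|S|.+1)).
Proof.
move=> tS S2 uU dU.
have rec : csynth S t U (N_SU_rec #|S|.+1).
  by apply: csynth_rec => //; [lia | move=> S1; rewrite S1 in S2].
case: leqP => // S6; rewrite minElt; case: ifP => // _.
exact: csynth_SU_linear.
Qed.

(** Every control beyond the first contributes one SU summand and leaves a phase gate with one
    control less; at one control the sum is empty and the 2 remains. *)
Lemma csynth_U c S t U : t \notin S -> #|S| = c.+1 -> U \is unitarymx ->
  csynth S t U (N_U d c.+2).
Proof.
elim: c S t U => [|c IH] S t U tS cS uU.
  have /cards1P[i Si] := introT eqP cS.
  rewrite /N_U big_geq // addr0 Si; apply: csynth1_unitary => //.
  by apply: contraNneq tS => <-; rewrite Si set11.
have [x xS] : exists x, x \in S by apply/card_gt0P; rewrite cS.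
have [s s1 ds] := scaled_to_SU uU.
have s0 : s != 0 by rewrite -normr_gt0 s1.
have -> : U = s^-1 *: (s *: U) by rewrite scalerA mulVf // scale1r.
rewrite /N_U big_nat_recr //= addrA.
apply: (csynth_phase tS xS); last first.
  by rewrite -cS; apply: csynth_SU => //; [rewrite cS | apply: unitaryZ].
apply: IH; first by rewrite setD11.
  by move: cS; rewrite (cardsD1 x) xS => -[].
by apply: phase_mx_unitary; rewrite normfV s1 invr1.
Qed.

End Bounds.

(** * The model of qudit circuits *)

Section Circuits.
Variables (R : realType) (n p : nat).
Local Notation d := p.+2.
Local Notation op := (qop R n d).
Implicit Types (A B : op) (N K : int) (j i t : 'I_n).

Lemma local_gate_scalar i j (s : R[i]) :
  local_gate i s%:M = local_gate j s%:M :> op.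
Proof.
have E k : local_gate k s%:M = s *: (1 : op).
  rewrite -(local_gate1 R d k) -[s%:M]scalemx1; apply/matrixP => a b; rewrite !mxE.
  by rewrite /local_coef !mxE; case: ifP => _; rewrite ?mulr0.
by rewrite !E.
Qed.

Lemma last_mxE : last_mx R d = level_mx _ ord_max.
Proof.
apply/matrixP => i j; rewrite !mxE eqxx /= eqSS.
by case: (i =P j) => [->|_]; rewrite ?mulr1n ?mulr0n.
Qed.

Lemma synthesizable_gate g : wf_gate g ->
  synthesizable (gate_op g : op) (is_CINC g)%:Z.
Proof.
move=> wg; exists [:: g]; split; rewrite /= ?wg ?addn0 //.
by rewrite -[RHS]/(\prod_(h <- [:: g]) (gate_op h : op)) big_seq1.
Qed.

Lemma synthesizableM A B N K : synthesizable A N -> synthesizable B K ->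
  synthesizable (A * B) (N + K).
Proof.
move=> [c [wc -> cN]] [e [we -> eK]]; exists (c ++ e); split.
- by rewrite all_cat wc.
- by rewrite -[RHS]/(\prod_(g <- c ++ e) (gate_op g : op)) big_cat.
- by rewrite count_cat PoszD lerD.
Qed.

Lemma synthesizable_le A N K : synthesizable A N -> N <= K -> synthesizable A K.
Proof.
by move=> [c [wc -> cN]] NK; exists c; split=> //; apply: le_trans NK.
Qed.

Lemma synthesizable_local j V : V \is unitarymx ->
  synthesizable (local_gate j V : op) 0.
Proof. exact: (@synthesizable_gate (Single j V)). Qed.

Lemma local_gateK j (V : 'M[R[i]]_d) : V \is unitarymx ->
  local_gate j V * local_gate j V^-1 = 1 :> op.
Proof.
move=> uV; rewrite -local_gateM; have := unitary_mulmxV uV.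
by rewrite -mulmxE => ->; apply: local_gate1.
Qed.

Lemma gate_inv g : wf_gate g -> exists2 B, gate_op g * B = 1 :> op &
  synthesizable B (is_CINC g)%:Z.
Proof.
case: g => [j V|i t] /=.
  move=> uV; exists (local_gate j V^-1); first exact: local_gateK.
  exact/synthesizable_local/unitaryV.
move=> it; have ti : t \notin [set i] by rewrite inE eq_sym.
pose J := rev_mx R[i] p; have uJ : J \is unitarymx by apply: perm_mx_unitary.
have JJ : J * J = 1.
  rewrite -mulmxE -perm_mxM; apply: etrans (perm_mx1 _ _); congr perm_mx.
  by apply/permP => k; rewrite permM !permE /= rev_ordK.
have lJ : local_gate t J * local_gate t J = 1 :> op.
  by rewrite -local_gateM mulmxE JJ; apply: local_gate1.
exists (local_gate t J * ctrl_gate [set i] t (shift_mx R d) * local_gate t J).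
  rewrite ctrl_gateE // ctl_conj //; last exact: comm_proj_local.
  rewrite -ctlM ?projK //; last exact: comm_proj_local.
  rewrite -!local_gateM !mulmxE (cyclic_rev R[i] p).
  by rewrite local_gate1 ctl1.
rewrite -[true%:Z]addr0 -[true%:Z]add0r.
apply: synthesizableM; last exact: synthesizable_local.
apply: synthesizableM; first exact: synthesizable_local.
exact: (@synthesizable_gate (CINC R d i t)).
Qed.

Lemma synthesizable_inv A N : synthesizable A N ->
  exists2 B, A * B = 1 & synthesizable B N.
Proof.
move=> [c [wc -> cN]].
suff [B cB sB] : exists2 B, (\prod_(g <- c) gate_op g) * B = 1 :> op &
    synthesizable B (count (@is_CINC R n d) c)%:Z.
  by exists B => //; apply: synthesizable_le cN.
elim: c wc {cN} => [|g c IH] /=.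
  by exists 1; [rewrite big_nil mulr1 | exists [::]; split; rewrite ?big_nil].
move=> /andP[wg /IH [B cB sB]]; have [G gG sG] := gate_inv wg.
exists (B * G).
  by rewrite big_cons !mulrA -[_ * B]mulrA cB mulr1.
by rewrite addnC PoszD; apply: synthesizableM.
Qed.

Definition qudit_model : circuit_model R[i] n p.
Proof.
apply: (@CircuitModel _ n p op (@local_gate R n d) (@proj R n d)
  (@synthesizable R n d)).
- exact: local_gate1.
- exact: local_gateM.
- exact: local_gateD.
- exact: local_gate_scalar.
- exact: local_gate_comm.
- exact: proj0.
- exact: projU.
- by move=> i; rewrite proj_set1 last_mxE.
- by move=> S a H; apply: comm_proj => i iS; rewrite last_mxE; apply: H.
- exact: synthesizable_local.
- move=> i t it; have := @synthesizable_gate (CINC R d i t) it.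
  by rewrite /= ctrl_gateE // inE eq_sym.
- exact: synthesizableM.
- exact: synthesizable_le.
- exact: synthesizable_inv.
(* The fields stay transparent, so that [csynth] over this model converts to a statement about
   [synthesizable]. *)
Defined.

End Circuits.

(** * The quadratic bounds *)

Lemma N_U_recr d n : (2 <= n)%N -> N_U d n.+1 = N_U d n +
  (if (n.+1 <= 6)%N then N_SU_rec n.+1 else Num.min (N_SU_rec n.+1) (N_SU d n.+1)).
Proof. by move=> n2; rewrite /N_U big_nat_recr //= addrA. Qed.

(** Bounding the minimum at m = 7 by the recursive count 40 gives a starting value valid for every
    d. *)
Lemma N_U7 d : N_U d 7 <= 100.
Proof.
have E2 : N_U d 2 = 2 by rewrite /N_U big_geq // addr0.
have E3 : N_SU_rec 3 = 4 by rewrite (@N_SU_recE 1 2).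
have E4 : N_SU_rec 4 = 10 by rewrite (@N_SU_recE 1 3).
have E5 : N_SU_rec 5 = 16 by rewrite (@N_SU_recE 2 4).
have E6 : N_SU_rec 6 = 28 by rewrite (@N_SU_recE 2 5).
have E7 : N_SU_rec 7 = 40 by rewrite (@N_SU_recE 2 6).
rewrite 5?N_U_recr // E2 E3 E4 E5 E6 E7.
apply: (@le_trans _ _ (2 + 4 + 10 + 16 + 28 + 40)); last by [].
by rewrite lerD2l ge_min lexx.
Qed.

(** The increment of a n^2 + b n + c from m - 1 to m is a (2 m - 1) + b, which matches the linear
    count exactly; only the value at 7 has to be compared. *)
Lemma N_U_quadratic d n (a b c : int) : (7 <= n)%N ->
  100 <= a * 49 + b * 7 + c ->
  (forall m : nat, N_SU d m = a * (2 * m%:Z - 1) + b) ->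
  N_U d n <= a * n%:Z ^+ 2 + b * n%:Z + c.
Proof.
move=> n7 H7 HN; elim: n n7 => // n IH; rewrite leq_eqVlt => /orP[/eqP <-|n7].
  exact: le_trans (N_U7 d) H7.
rewrite N_U_recr; last by lia.
have -> : (n.+1 <= 6)%N = false by lia.
apply: (@le_trans _ _ (a * n%:Z ^+ 2 + b * n%:Z + c + N_SU d n.+1)).
  by rewrite lerD ?IH // ge_min lexx orbT.
by rewrite HN intS le_eqVlt; apply/orP; left; apply/eqP; ring.
Qed.

Theorem mainTheorem2 (R : realType) (d n : nat) (hd : (2 <= d)%N)
    (hn : (3 <= n)%N) (U : 'M[R[i]]_d) (hU : U \is unitarymx) :
  (forall t : 'I_n, t = n.-1 :> nat ->
     synthesizable (ctrl_gate [set i : 'I_n | (i < n.-1)%N] t U) (N_U d n))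
  /\
  ((7 <= n)%N ->
   [/\ d = 2%N -> N_U d n <= 8 * n%:Z ^+ 2 - 40 * n%:Z + 12,
       d = 3%N -> N_U d n <= 16 * n%:Z ^+ 2 - 144 * n%:Z + 348
     & (4 <= d)%N ->
       N_U d n <= (16 * d%:Z - 20) * n%:Z ^+ 2
                  - (176 * d%:Z - 252) * n%:Z + (490 * d%:Z - 732)]).
Proof.
split=> [t tn|n7]; last first.
  split=> [->|->|d4]; rewrite -mulNr; apply: N_U_quadratic => //.
  - by move=> m; rewrite /N_SU /=; ring.
  - by move=> m; rewrite /N_SU /=; ring.
  - lia.
  move=> m; rewrite /N_SU; case: eqP => [d2|_]; first by lia.
  by case: eqP => [d3|_]; [lia | ring].
case: d hd U hU => [|[|p]] // _ U uU.
have tS : t \notin [set i : 'I_n | (i < n.-1)%N] by rewrite inE tn ltnn.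
have cS : #|[set i : 'I_n | (i < n.-1)%N]| = n.-2.+1.
  have -> : [set i : 'I_n | (i < n.-1)%N] = [set~ t].
    by apply/setP => i; rewrite !inE -val_eqE /= tn; have := ltn_ord i; lia.
  by rewrite cardsC1 card_ord; lia.
have := csynth_U (qudit_model R n p) tS cS uU.
have -> : n.-2.+2 = n by lia.
by rewrite ctrl_gateE.
Qed.
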